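(* Let $k\geqslant2$ and $d\geqslant1$ be integers. Then there exist an integer $s>d$ and a positive semidefinite operator $X$ on $\mathbb C^k\otimes\mathbb C^s$ which is entangled, such that for every isometry $V\colon\mathbb C^d\to\mathbb C^s$ the compressed operator $(I_k\otimes V)^*X(I_k\otimes V)$ on $\mathbb C^k\otimes\mathbb C^d$ is separable.
   Context: A positive semidefinite operator on $\mathbb C^k\otimes\mathbb C^s$ is separable if it is a finite sum $\sum_\nu p_\nu\otimes b_\nu$ with $p_\nu\in\mathrm{Mat}_k(\mathbb C)$ and $b_\nu\in\mathrm{Mat}_s(\mathbb C)$ positive semidefinite; it is entangled if it is not separable. No trace normalization is imposed. *)

(* Defs.v *)
From mathcomp Require Import all_boot all_order all_algebra.
From mathcomp Require Import spectral.
From mathcomp Require mxtens.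
From mathcomp Require Import complex reals.
Set Implicit Arguments.
Unset Strict Implicit.
Unset Printing Implicit Defensive.
Import Order.TTheory GRing.Theory Num.Theory.
Local Open Scope ring_scope.
Local Open Scope sesquilinear_scope.

(* C^n is the space of column vectors 'cV[C]_n, and operators act on the left.
   C^k (x) C^s is identified with C^(k * s) through [mxtens.mxtens_index],
   i.e. e_i (x) e_j is the basis vector of index i * s + j.
   [mxtens] is not imported because its tensor-power notation [A ^t k] competes
   with the conjugate-transpose notation [A ^t*] of [spectral]. *)
Notation "A *t B" := (mxtens.tensmx A B)
  (at level 40, left associativity, format "A  *t  B") : ring_scope.

Definition psdmx (C : numClosedFieldType) (n : nat) (X : 'M[C]_n) : Prop :=
  X \is hermsymmx /\ forall v : 'cV[C]_n, 0 <= (v ^t* *m X *m v) 0 0.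

Definition separable (C : numClosedFieldType) (k s : nat)
    (X : 'M[C]_(k * s)) : Prop :=
  psdmx X /\
  exists (m : nat) (p : 'I_m -> 'M[C]_k) (b : 'I_m -> 'M[C]_s),
    (forall nu, psdmx (p nu) /\ psdmx (b nu)) /\
    X = \sum_(nu < m) p nu *t b nu.

Definition entangled (C : numClosedFieldType) (k s : nat)
    (X : 'M[C]_(k * s)) : Prop :=
  psdmx X /\ ~ separable X.

(* The matrix V : C^d -> C^s is an isometry; [unitarymx] is not used directly
   because it requires V *m V ^t* = 1%:M, i.e. that V be a coisometry. *)
Definition isometrymx (C : numClosedFieldType) (s d : nat)
    (V : 'M[C]_(s, d)) : Prop :=
  V ^t* *m V = 1%:M.

Definition compression (C : numClosedFieldType) (k s d : nat)
    (V : 'M[C]_(s, d)) (X : 'M[C]_(k * s)) : 'M[C]_(k * d) :=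
  ((1%:M : 'M[C]_k) *t V) ^t* *m X *m ((1%:M : 'M[C]_k) *t V).

(* Main.v *)
(* A maximal-cone argument separates a non-separable Hermitian matrix from the
   separable cone by a dual witness.  So it suffices to find X with
   chain_witness X < 0, where chain_witness is a fixed functional that is
   nonnegative on products, but tr (W X) > 0 for every dual witness W whose
   off-diagonal block has rank at most d: both vv^* and the lift (I (x) V) W (I (x) V)^*
   of a witness on C^k (x) C^d are of this kind.

   The functional lives on a chain of sites joined by edges j, j.+1.  Near the
   unit circle it almost vanishes, to third order in t = |z| - 1, at the products
   (1, z) (x) zero_vector; X is a large multiple of the sum of these product
   projections at many unit points and at t, -t, plus a small multiple of the
   identity, minus an exchange term on the middle edge that makes
   chain_witness X negative.  If low-rank witnesses with tr (W X) <= 0 existed for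
   arbitrarily small t, their limit along an ultrafilter would annihilate the
   curve of zero vectors to first order on the unit circle.  Comparing
   coefficients forces the off-diagonal block of the limit to be Hermitian (after
   a shift) and to couple only edges of equal slope, and a rank less than the
   length of each half of the chain gives kernel vectors supported on either
   half.  From these one builds a real test vector at which the limit witness is
   a positive multiple of its middle off-diagonal entry; hence that entry is
   nonnegative, whereas the exchange term keeps it negative. *)
Require Import Defs.
From mathcomp Require Import all_boot all_order all_algebra.
From mathcomp Require Import spectral.
From mathcomp Require Import complex reals.
From mathcomp Require Import boolp classical_sets filter.
From mathcomp Require Import ring lra zify.
Set Implicit Arguments.
Unset Strict Implicit.
Unset Printing Implicit Defensive.
Import Order.TTheory GRing.Theory Num.Theory.
Local Open Scope ring_scope.
Local Open Scope sesquilinear_scope.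

(** * Positive semidefinite matrices *)

Section Psd.
Context {C : numClosedFieldType}.

Lemma adjmx_mul m n p (A : 'M[C]_(m, n)) (B : 'M[C]_(n, p)) :
  (A *m B) ^t* = B ^t* *m A ^t*.
Proof. by rewrite trmx_mul map_mxM. Qed.

Lemma adjmxD m n (A B : 'M[C]_(m, n)) : (A + B) ^t* = A ^t* + B ^t*.
Proof. by rewrite linearD map_mxD. Qed.

Lemma adjmxZ m n (a : C) (A : 'M[C]_(m, n)) : (a *: A) ^t* = a^* *: A ^t*.
Proof. by rewrite linearZ map_mxZ. Qed.

Lemma adjmx_tens m n p q (A : 'M[C]_(m, n)) (B : 'M[C]_(p, q)) :
  (A *t B) ^t* = A ^t* *t B ^t*.
Proof. by rewrite mxtens.trmx_tens mxtens.map_mxT. Qed.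

Lemma hermsymmxP n (M : 'M[C]_n) : reflect (M ^t* = M) (M \is hermsymmx).
Proof.
by apply: (iffP (is_hermitianmxP _ _ _)); rewrite expr0 scale1r.
Qed.

Lemma mxE_herm n (M : 'M[C]_n) i j : M ^t* = M -> (M i j)^* = M j i.
Proof. by move=> {2}<-; rewrite !mxE. Qed.

Definition qform n (M : 'M[C]_n) (v : 'cV[C]_n) : C := (v ^t* *m M *m v) 0 0.

Lemma qformE n (M : 'M[C]_n) v :
  qform M v = \sum_i \sum_j (v i 0)^* * M i j * v j 0.
Proof.
rewrite /qform -mulmxA mxE; apply: eq_bigr => i _.
by rewrite !mxE mulr_sumr; apply: eq_bigr => j _; rewrite mulrA.
Qed.

Lemma qformD n (A B : 'M[C]_n) v : qform (A + B) v = qform A v + qform B v.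
Proof. by rewrite /qform mulmxDr mulmxDl mxE. Qed.

Lemma qformZ n a (A : 'M[C]_n) v : qform (a *: A) v = a * qform A v.
Proof. by rewrite /qform -scalemxAr -scalemxAl mxE. Qed.

Lemma mulJ_ge0 (a : C) : 0 <= a^* * a.
Proof. by rewrite mulrC mul_conjC_ge0. Qed.

Lemma gram_psd m n (A : 'M[C]_(m, n)) : psdmx (A ^t* *m A).
Proof.
split; first by apply/hermsymmxP; rewrite adjmx_mul trmxCK.
move=> v; rewrite -!mulmxA mulmxA -adjmx_mul mxE sumr_ge0// => i _.
by rewrite !mxE mulJ_ge0.
Qed.

Lemma psd0 n : psdmx (0 : 'M[C]_n).
Proof. by have := gram_psd (0 : 'M[C]_n); rewrite mulmx0. Qed.

Lemma psd1 n : psdmx (1%:M : 'M[C]_n).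
Proof. by have := gram_psd (1%:M : 'M[C]_n); rewrite mulmx1 trmx1 map_mx1. Qed.

Lemma psdD n (A B : 'M[C]_n) : psdmx A -> psdmx B -> psdmx (A + B).
Proof.
move=> [/hermsymmxP hA pA] [/hermsymmxP hB pB]; split=> [|v].
  by apply/hermsymmxP; rewrite adjmxD hA hB.
by rewrite -/(qform _ _) qformD addr_ge0 //; [exact: pA|exact: pB].
Qed.

Lemma psdZ n a (A : 'M[C]_n) : 0 <= a -> psdmx A -> psdmx (a *: A).
Proof.
move=> a0 [/hermsymmxP hA pA]; split=> [|v].
  by apply/hermsymmxP; rewrite adjmxZ hA (CrealP _)// ger0_real.
by rewrite -/(qform _ _) qformZ mulr_ge0 //; exact: pA.
Qed.

Lemma psd_sum n I (r : seq I) (P : pred I) (F : I -> 'M[C]_n) :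
  (forall i, P i -> psdmx (F i)) -> psdmx (\sum_(i <- r | P i) F i).
Proof. by move=> FP; apply: big_ind => //; [exact: psd0|exact: psdD]. Qed.

Lemma rank1_psd n (v : 'cV[C]_n) : psdmx (v *m v ^t*).
Proof. by have := gram_psd (v ^t*); rewrite trmxCK. Qed.

(** Spectral decomposition with each eigenvalue absorbed as a square root into its eigenvector. It
    reduces statements about products of semidefinite matrices to products of vectors. *)
Lemma psd_rank1_sum n (A : 'M[C]_n) : psdmx A ->
  exists v : 'I_n -> 'cV[C]_n, A = \sum_i v i *m (v i) ^t*.
Proof.
move=> [hA pA]; have /orthomx_spectralP AE := hermitian_normalmx hA.
set P := spectralmx A in AE; set D := spectral_diag A in AE.
have uP : P \is unitarymx by exact: spectral_unitarymx.
rewrite (invmx_unitary uP) in AE.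
have PP : P *m P ^t* = 1%:M by exact/unitarymxP.
have D0 i : 0 <= D 0 i.
  have := pA (P ^t* *m delta_mx i 0).
  rewrite -/(qform _ _) /qform AE adjmx_mul trmxCK !mulmxA.
  rewrite -!(mulmxA _ P (P ^t*)) PP !mulmx1.
  rewrite -mulmxA mul_diag_mx mxE (bigD1 i)//= big1 ?addr0 => [|j ji]; last first.
    by rewrite !mxE (negbTE ji) /= !mulr0.
  by rewrite !mxE !eqxx /= conjC1 mul1r mulr1.
exists (fun i => sqrtC (D 0 i) *: (row i P) ^t*).
rewrite {1}AE; apply/matrixP => a b; rewrite summxE mxE.
apply: eq_bigr => i _; rewrite mul_mx_diag !mxE big_ord1 !mxE.
rewrite rmorphM /= conjCK.
have -> : (sqrtC (D 0 i))^* = sqrtC (D 0 i) by rewrite (CrealP _)// ger0_real// sqrtC_ge0.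
by rewrite -{1}(sqrtCK (D 0 i)) expr2; ring.
Qed.

Lemma tens_psd k s (p : 'M[C]_k) (b : 'M[C]_s) :
  psdmx p -> psdmx b -> psdmx (p *t b).
Proof.
move=> /psd_rank1_sum[v ->] /psd_rank1_sum[w ->].
rewrite (_ : _ *t _ = \sum_i \sum_j (v i *m (v i)^t*) *t (w j *m (w j)^t*)).
  apply: psd_sum => i _; apply: psd_sum => j _.
  have := gram_psd (v i ^t* *t w j ^t*).
  by rewrite adjmx_tens !trmxCK mxtens.tensmx_mul.
apply/matrixP => i j; case: (mxtens.mxtens_indexP i) => a b'.
case: (mxtens.mxtens_indexP j) => c e; rewrite mxtens.tensmxE !summxE mulr_suml.
apply: eq_bigr => x _; rewrite summxE mulr_sumr; apply: eq_bigr => y _.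
by rewrite mxtens.tensmxE.
Qed.

End Psd.

(** * Separation from the separable cone *)

Section Cone.
Local Open Scope complex_scope.
Context {R : realType} {V : lmodType R[i]}.
Local Notation "r *~: x" := ((r : R)%:C *: x) (at level 40).

Definition convex_cone (K : set V) : Prop :=
  (forall x y, K x -> K y -> K (x + y)) /\
  (forall (r : R) x, 0 <= r -> K x -> K (r *~: x)).

(** Zorn's lemma. If a maximal cone A avoiding [- u] misses x, then adjoining x produces
    [- u = k + t x] with t > 0, so [- x] is a positive multiple of [k + u] and lies in A. *)
Lemma maximal_cone (K : set V) (u : V) : K u -> convex_cone K -> ~ K (- u) ->
  exists A : set V, [/\ (K `<=` A)%classic, convex_cone A, ~ A (- u)
    & forall x, A x \/ A (- x)].
Proof.
move=> Ku cK nK.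
pose P A := A = set0 \/ [/\ (K `<=` A)%classic, convex_cone A & ~ A (- u)].
have [F FP Ftot|A [[A0|[KA cA nA]] Amax]] := @Zorn_bigcup _ P.
- have [[X FX [x Xx]]|F0] := pselect (exists2 X, F X & exists x, X x).
    right; have good Y : F Y -> (exists y, Y y) ->
        [/\ (K `<=` Y)%classic, convex_cone Y & ~ Y (- u)].
      by move=> FY [y Yy]; case: (FP _ FY) => // Y0; rewrite Y0 in Yy.
    split.
    + move=> y Ky; exists X => //.
      by have [KX _ _] := good _ FX (ex_intro _ x Xx); exact: KX.
    + split=> [y y' [Y FY Yy] [Y' FY' Yy']|r y r0 [Y FY Yy]]; last first.
        by exists Y => //; have [_ [_ +] _] := good _ FY (ex_intro _ y Yy); apply.
      have [YY'|Y'Y] := Ftot _ _ FY FY'.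
        exists Y' => //; have [_ [+ _] _] := good _ FY' (ex_intro _ _ Yy').
        by apply => //; exact: YY'.
      exists Y => //; have [_ [+ _] _] := good _ FY (ex_intro _ _ Yy).
      by apply => //; exact: Y'Y.
    + by move=> [Y FY Yu]; have [_ _] := good _ FY (ex_intro _ _ Yu); apply.
  left; rewrite -subset0 => x [X FX Xx].
  by apply: F0; exists X => //; exists x.
- exfalso; apply: (Amax K); last by right; split.
  by rewrite A0; split=> [?//|/(_ u Ku)].
exists A; split=> // x; have [Ax|nAx] := pselect (A x); first by left.
right; apply: contrapT => nAnx.
pose B : set V := fun y => exists2 k, A k & exists2 t : R, 0 <= t & y = k + t *~: x.
apply: (Amax B); last right.
  split.
    by move=> y Ay; exists y => //; exists 0 => //; rewrite scale0r addr0.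
  move=> /(_ x) BA; apply: nAx; apply: BA; exists 0; last first.
    by exists 1 => //; rewrite scale1r add0r.
  by rewrite -(scale0r u) -[0]/((0 : R)%:C); apply: cA.2 => //; exact: KA.
split.
- by move=> y /KA Ay; exists y => //; exists 0 => //; rewrite scale0r addr0.
- split=> [_ _ [k Ak [t t0 ->]] [k' Ak' [t' t0' ->]]|r _ r0 [k Ak [t t0 ->]]].
    exists (k + k'); first exact: cA.1.
    by exists (t + t'); [exact: addr_ge0|rewrite rmorphD scalerDl addrACA].
  exists (r *~: k); first exact: cA.2.
  by exists (r * t); [exact: mulr_ge0|rewrite scalerDr scalerA rmorphM].
- move=> [k Ak [t t0 uE]].
  have [t00|tN0] := eqVneq t 0.
    by apply: nA; rewrite uE t00 scale0r addr0.
  apply: nAnx.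
  have -> : - x = t^-1 *~: (k + u).
    apply: (scalerI (_ : t%:C != 0)); first by rewrite (inj_eq (@complexI R)) .
    rewrite scalerA -rmorphM divff// scale1r scalerN.
    by rewrite -[u]opprK uE opprD addNKr.
  by apply: cA.2; [rewrite invr_ge0|apply: cA.1 => //; exact: KA].
Qed.

(** A maximal cone A containing K and [- z] but not [- u] is a half-space in disguise: f x is the
    supremum of the t with [x - t u] in A. Since A contains x or [- x] for every x, f is additive,
    and f z is nonpositive because [- z] is in A. *)
Lemma cone_separation (K : set V) (u z : V) : K u -> convex_cone K ->
  (forall x, exists t : R, K (x + t *~: u)) -> ~ K z ->
  exists f : V -> R, [/\ {morph f : x y / x + y}, forall r x, f (r *~: x) = r * f x,
    forall x, K x -> 0 <= f x, f u = 1 & f z <= 0].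
Proof.
move=> Ku cK Kabs nKz.
have K0 : K 0 by rewrite -(scale0r u) -[0]/((0 : R)%:C); exact: cK.2.
pose K' : set V := fun y => exists2 k, K k & exists2 t : R, 0 <= t & y = k - t *~: z.
have KK' x : K x -> K' x.
  by move=> Kx; exists x => //; exists 0 => //; rewrite scale0r subr0.
have [] := @maximal_cone K' u (KK' _ Ku).
- split=> [_ _ [k Kk [t t0 ->]] [k' Kk' [t' t0' ->]]|r _ r0 [k Kk [t t0 ->]]].
    exists (k + k'); first exact: cK.1.
    by exists (t + t'); [exact: addr_ge0|rewrite rmorphD scalerDl opprD addrACA].
  exists (r *~: k); first exact: cK.2.
  by exists (r * t); [exact: mulr_ge0|rewrite scalerBr scalerA rmorphM].
- move=> [k Kk [t t0 uE]]; have tzE : t *~: z = k + u.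
    by rewrite -[u]opprK uE opprB addrCA subrr addr0.
  have [t00|tN0] := eqVneq t 0.
    (* With t = 0 the cone K contains both u and [- u], so absorption by multiples of u would put z
       itself in K. *)
    move: tzE; rewrite t00 scale0r => /esym/eqP; rewrite addrC addr_eq0 => /eqP uk.
    have KNu : K (- u) by rewrite uk opprK.
    have [s Ksz] := Kabs z; apply: nKz.
    have [s0|/ltW s0] := lerP 0 s.
      rewrite -(addrK (s *~: u) z) -scalerN; apply: cK.1 => //; exact: cK.2.
    rewrite -(addrK (s *~: u) z) -scaleNr -rmorphN; apply: cK.1 => //.
    by apply: cK.2 => //; rewrite oppr_ge0.
  apply: nKz; have -> : z = t^-1 *~: (k + u).
    by rewrite -tzE scalerA -rmorphM mulVf// scale1r.
  by apply: cK.2; [rewrite invr_ge0|exact: cK.1].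
move=> A [K'A cA nA Atot].
have KA x : K x -> A x by move=> /KK'/K'A.
have Au := KA _ Ku; have A0 := KA _ K0.
pose S x : set R := fun t => A (x - t *~: u).
have SP x t s : A (x - t *~: u) -> A (- x + s *~: u) -> t <= s.
  move=> h1 h2; rewrite leNgt; apply/negP => st; apply: nA.
  have -> : - u = (t - s)^-1 *~: ((x - t *~: u) + (- x + s *~: u)).
    rewrite addrACA subrr add0r.
    have -> : - (t *~: u) + s *~: u = (t - s) *~: (- u).
      by rewrite scalerN rmorphB scalerBl opprB addrC.
    rewrite scalerA -rmorphM mulVf ?scale1r//.
    by rewrite subr_eq0 gt_eqF.
  by apply: cA.2; [rewrite invr_ge0 subr_ge0 ltW|exact: cA.1].
have supS x : has_sup (S x).
  split.
    by have [t /KA ?] := Kabs x; exists (- t); rewrite /S rmorphN scaleNr opprK.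
  have [s /KA As] := Kabs (- x); exists s => t St; exact: SP As.
pose f x := sup (S x).
have fge x t : A (x - t *~: u) -> t <= f x.
  by move=> h; exact: (ub_le_sup (supS x).2).
have flt x t : t < f x -> A (x - t *~: u).
  move=> /(sup_gt (supS x).1) [t' St' tt'].
  have -> : x - t *~: u = x - t' *~: u + (t' - t) *~: u.
    by rewrite rmorphB scalerBl addrA subrK.
  by apply: cA.1 => //; apply: cA.2 => //; rewrite subr_ge0 ltW.
have fgt x t : f x < t -> A (t *~: u - x).
  move=> xt; have [h|] := Atot (x - t *~: u); last by rewrite opprB.
  by have := fge _ _ h; rewrite leNgt xt.
have f0 : f 0 = 0.
  apply/eqP; rewrite eq_le fge ?scale0r ?subr0// andbT.
  apply: ge_sup; first exact: (supS 0).1.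
  by move=> t h; apply: (SP 0) => //; rewrite oppr0 add0r scale0r.
have fsup x y : f x + f y <= f (x + y).
  apply/ler_addgt0Pr => e e0; rewrite -lerBlDr; apply: fge.
  have -> : x + y - (f x + f y - e) *~: u
    = (x - (f x - e / 2) *~: u) + (y - (f y - e / 2) *~: u).
    rewrite addrACA -opprD -scalerDl -rmorphD; congr (_ + _ - _%:C *: _); lra.
  by apply: cA.1; apply: flt; lra.
have fN x : f (- x) = - f x.
  apply/eqP; rewrite eq_le; apply/andP; split.
    by rewrite -subr_ge0 opprK -opprD oppr_ge0 -f0 -[X in f X](addrN x) addrC fsup
      || by have := fsup x (- x); rewrite subrr f0; lra.
  rewrite lerNl; apply/ler_addgt0Pr => e e0; rewrite lerNl.
  apply: fge; rewrite rmorphN scaleNr opprK addrC.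
  by apply: fgt; rewrite ltrDl.
have fD x y : f (x + y) = f x + f y.
  apply/eqP; rewrite eq_le fsup andbT.
  have := fsup (x + y) (- y); rewrite addrK fN; lra.
have fZp r x : 0 < r -> r * f x <= f (r *~: x).
  move=> r0; rewrite -ler_pdivlMl//; apply/ler_addgt0Pr => e e0.
  rewrite -lerBlDr ler_pdivlMl//; apply: fge.
  rewrite rmorphM -scalerA -scalerBr; apply: cA.2; first exact: ltW.
  by apply: flt; lra.
have fZp' r x : 0 < r -> f (r *~: x) = r * f x.
  move=> r0; apply/eqP; rewrite eq_le fZp// andbT.
  have := fZp r^-1 (r *~: x); rewrite invr_gt0 => /(_ r0).
  by rewrite scalerA -rmorphM mulVf ?gt_eqF// scale1r -ler_pdivlMl ?invr_gt0// invrK.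
exists f; split=> //.
- move=> r x; have [r0|r0|->] := ltgtP r 0; last by rewrite scale0r f0 mul0r.
    rewrite -[r]opprK rmorphN scaleNr fN fZp' ?oppr_gt0//; lra.
  exact: fZp'.
- by move=> x /KA Ax; apply: fge; rewrite scale0r subr0.
- apply/eqP; rewrite eq_le fge ?scale1r ?subrr// andbT.
  apply: ge_sup; first exact: (supS u).1.
  by move=> t h; apply: (SP u) => //; rewrite scale1r addNr.
- rewrite -oppr_ge0 -fN; apply: fge; rewrite scale0r subr0; apply: K'A.
  by exists 0 => //; exists 1 => //; rewrite scale1r add0r.
Qed.

End Cone.

(** * The separable cone and the identity as its order unit *)

Section SepCone.
Context {C : numClosedFieldType} {k s : nat}.

Definition sepsum (M : 'M[C]_(k * s)) : Prop :=
  exists (m : nat) (p : 'I_m -> 'M[C]_k) (b : 'I_m -> 'M[C]_s),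
    (forall nu, psdmx (p nu) /\ psdmx (b nu)) /\
    M = \sum_(nu < m) p nu *t b nu.

Lemma tensDl m n p q (A B : 'M[C]_(m, n)) (D : 'M[C]_(p, q)) :
  (A + B) *t D = A *t D + B *t D.
Proof. by apply/matrixP => i j; rewrite !mxE mulrDl. Qed.

Lemma tensDr m n p q (A B : 'M[C]_(m, n)) (D : 'M[C]_(p, q)) :
  D *t (A + B) = D *t A + D *t B.
Proof. by apply/matrixP => i j; rewrite !mxE mulrDr. Qed.

Lemma tensZl m n p q a (A : 'M[C]_(m, n)) (D : 'M[C]_(p, q)) :
  (a *: A) *t D = a *: (A *t D).
Proof. by apply/matrixP => i j; rewrite !mxE mulrA. Qed.

Lemma tensZr m n p q a (A : 'M[C]_(m, n)) (D : 'M[C]_(p, q)) :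
  D *t (a *: A) = a *: (D *t A).
Proof. by apply/matrixP => i j; rewrite !mxE mulrCA. Qed.

Lemma tensmx11 : (1%:M : 'M[C]_k) *t (1%:M : 'M[C]_s) = 1%:M.
Proof.
apply/matrixP => i j; case: (mxtens.mxtens_indexP i) => a b.
case: (mxtens.mxtens_indexP j) => a' b'; rewrite mxtens.tensmxE !mxE.
by rewrite (can_eq (@mxtens.mxtens_indexK _ _)) xpair_eqE -natrM mulnb.
Qed.

Lemma sepsum_tens p b : psdmx p -> psdmx b -> sepsum (p *t b).
Proof.
move=> hp hb; exists 1, (fun=> p), (fun=> b); split=> //.
by rewrite big_ord1.
Qed.

Lemma sepsumD M N : sepsum M -> sepsum N -> sepsum (M + N).
Proof.
move=> [m [p [b [h ->]]]] [m' [p' [b' [h' ->]]]].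
exists (m + m')%N, (fun i => match split i with inl i => p i | inr i => p' i end),
  (fun i => match split i with inl i => b i | inr i => b' i end); split.
  by move=> i; case: (split i).
rewrite big_split_ord /=; congr (_ + _); apply: eq_bigr => i _.
  by rewrite -/(unsplit (inl i)) unsplitK.
by rewrite -/(unsplit (inr i)) unsplitK.
Qed.

Lemma sepsumZ a M : 0 <= a -> sepsum M -> sepsum (a *: M).
Proof.
move=> a0 [m [p [b [h ->]]]]; exists m, (fun i => a *: p i), b; split.
  by move=> i; have [? ?] := h i; split=> //; exact: psdZ.
by rewrite scaler_sumr; apply: eq_bigr => i _; rewrite tensZl.
Qed.

Lemma sepsum1 : sepsum 1%:M.
Proof. by rewrite -tensmx11; apply: sepsum_tens; exact: psd1. Qed.

Lemma sepsum0 : sepsum 0.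
Proof. by rewrite -(scale0r 1%:M); apply: sepsumZ => //; exact: sepsum1. Qed.

Lemma sepsum_psd M : sepsum M -> psdmx M.
Proof.
by move=> [m [p [b [h ->]]]]; apply: psd_sum => i _; have [? ?] := h i; exact: tens_psd.
Qed.

Lemma sepsum_separable M : sepsum M <-> separable M.
Proof. by split=> [h|[]//]; split; first exact: sepsum_psd. Qed.

End SepCone.

Lemma adjmx_scalar (C : numClosedFieldType) n (a : C) :
  (a%:M : 'M[C]_n) ^t* = (a^*)%:M.
Proof. by rewrite tr_scalar_mx map_scalar_mx. Qed.

Lemma adjmxN (C : numClosedFieldType) m n (A : 'M[C]_(m, n)) : (- A) ^t* = - A ^t*.
Proof. by rewrite linearN map_mxN. Qed.

Lemma psd_bound (C : numClosedFieldType) n (A : 'M[C]_n) : psdmx A ->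
  exists2 c : C, 0 <= c & psdmx (c%:M - A).
Proof.
move=> /psd_rank1_sum[v ->].
suff one (w : 'cV[C]_n) : exists2 c : C, 0 <= c & psdmx (c%:M - w *m w ^t*).
  have c_ (i : 'I_n) : {c : C | 0 <= c & psdmx (c%:M - v i *m (v i) ^t*)}.
    by have := one (v i) => /cid2[c ? ?]; exists c.
  exists (\sum_i s2val (c_ i)); first by rewrite sumr_ge0// => i _; case: (c_ i).
  rewrite raddf_sum -sumrB /=; apply: psd_sum => i _.
  by case: (c_ i).
pose P := w *m w ^t*; pose c := (w ^t* *m w) 0 0.
have c0 : 0 <= c by rewrite /c mxE sumr_ge0// => i _; rewrite !mxE mulJ_ge0.
have PP : P *m P = c *: P.
  rewrite /P mulmxA -(mulmxA w) [w ^t* *m w]mx11_scalar -/c.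
  by rewrite mul_mx_scalar -scalemxAl.
have hP : P ^t* = P by rewrite /P adjmx_mul trmxCK.
have c1 : 0 < c + 1 by rewrite ltr_pwDr.
exists (c + 1); first exact: ltW.
(* Since [P *m P = c *: P], the matrix is a positive multiple of a square plus P. Using c + 1 in
   place of c avoids dividing by zero when w = 0. *)
have -> : (c + 1)%:M - w *m w ^t*
    = (c + 1)^-1 *: (((c + 1)%:M - P) ^t* *m ((c + 1)%:M - P) + P).
  apply: (scalerI (lt0r_neq0 c1)); rewrite scalerA divff ?lt0r_neq0// scale1r.
  rewrite adjmxD adjmx_scalar adjmxN hP (CrealP _) ?ger0_real ?(ltW c1)//.
  rewrite mulmxDl !mulmxDr !mul_mx_scalar !mul_scalar_mx mulNmx mulmxN opprK PP -/P.
  by apply/matrixP => i j; rewrite !mxE; ring.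
apply: psdZ; first by rewrite invr_ge0 ltW.
by apply: psdD; [exact: gram_psd|exact: rank1_psd].
Qed.

Section Absorb.
Context {C : numClosedFieldType} {k s : nat}.

(** This is the order-unit property needed for cone separation: a multiple of the identity moves M
    into the separable cone. *)
Definition absorbed (M : 'M[C]_(k * s)) : Prop :=
  exists2 t : C, 0 <= t & sepsum (M + t *: 1%:M).

Lemma sepsum_absorbed M : sepsum M -> absorbed M.
Proof. by move=> h; exists 0; rewrite ?scale0r ?addr0. Qed.

Lemma absorbedD M N : absorbed M -> absorbed N -> absorbed (M + N).
Proof.
move=> [t t0 h] [t' t0' h']; exists (t + t'); first exact: addr_ge0.
by rewrite scalerDl addrACA; exact: sepsumD.
Qed.

Lemma absorbedZ (r : C) M : 0 <= r -> absorbed M -> absorbed (r *: M).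
Proof.
move=> r0 [t t0 h]; exists (r * t); first exact: mulr_ge0.
by rewrite -scalerA -scalerDr; exact: sepsumZ.
Qed.

Lemma absorbedN_tens (p : 'M[C]_k) (b : 'M[C]_s) :
  psdmx p -> psdmx b -> absorbed (- (p *t b)).
Proof.
move=> hp hb; have [c c0 hc] := psd_bound hp; have [e e0 he] := psd_bound hb.
exists (c * e); first exact: mulr_ge0.
have -> : - (p *t b) + (c * e) *: 1%:M
    = (c *: 1%:M) *t (e%:M - b) + (c%:M - p) *t b.
  rewrite -[c%:M]scalemx1 -[e%:M]scalemx1 -tensmx11.
  by apply/matrixP => i j; rewrite !mxE; ring.
apply: sepsumD; apply: sepsum_tens => //.
by apply: psdZ => //; exact: psd1.
Qed.

(** A Hermitian matrix is a quarter of the difference of the squares of 1 + h and 1 - h, so the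
    tensor product is a signed sum of four products of semidefinite matrices, each absorbed with
    either sign. *)
Lemma absorbed_herm_tens (h : 'M[C]_k) (g : 'M[C]_s) :
  h ^t* = h -> g ^t* = g -> absorbed (h *t g) /\ absorbed (- (h *t g)).
Proof.
move=> hh gg.
have P n (M : 'M[C]_n) e : M ^t* = M -> e \is Num.real ->
    psdmx ((1%:M + e *: M) *m (1%:M + e *: M)).
  move=> MM eR; have := gram_psd (1%:M + e *: M).
  by rewrite adjmxD adjmxZ MM adjmx_scalar conjC1 (CrealP eR).
have N1 : (-1 : C) \is Num.real by rewrite rpredN real1.
have sq n (M : 'M[C]_n) : M = 4^-1 *: ((1%:M + 1 *: M) *m (1%:M + 1 *: M)
     - (1%:M + (-1) *: M) *m (1%:M + (-1) *: M)).
  rewrite !mulmxDl !mulmxDr -!scalemxAl -!scalemxAr !mulmx1 !mul1mx.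
  by apply/matrixP => i j; rewrite !mxE; field.
have p1 := P _ _ 1 hh (real1 _); have p2 := P _ _ (-1) hh N1.
have q1 := P _ _ 1 gg (real1 _); have q2 := P _ _ (-1) gg N1.
set a1 := _ *m _ in p1; set a2 := _ *m _ in p2.
set b1 := _ *m _ in q1; set b2 := _ *m _ in q2.
have E : h *t g = 16^-1 *: (a1 *t b1 + (- (a1 *t b2)) + (- (a2 *t b1)) + a2 *t b2).
  rewrite (sq _ h) (sq _ g) -/a1 -/a2 -/b1 -/b2 tensZl tensZr scalerA.
  rewrite -[- b2]scaleN1r -[- a2]scaleN1r tensDl !tensDr !tensZl !tensZr.
  have -> : 4^-1 * 4^-1 = 16^-1 :> C.
    by field.
  by apply/matrixP => i j; rewrite !mxE; ring.
have E' : - (h *t g) = 16^-1 *: (- (a1 *t b1) + a1 *t b2 + a2 *t b1 + (- (a2 *t b2))).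
  by rewrite E -scalerN !opprD !opprK.
have pos p b : psdmx p -> psdmx b -> absorbed (p *t b).
  by move=> hp hb; exact/sepsum_absorbed/sepsum_tens.
by split; [rewrite E|rewrite E']; (apply: absorbedZ; first by rewrite invr_ge0);
  do !apply: absorbedD; (exact: pos || exact: absorbedN_tens).
Qed.

(** Expand M in tensor products of matrix units and split each factor into Hermitian and skew parts;
    in the sum with the adjoint only products of Hermitian matrices survive. *)
Lemma absorbed_adj (M : 'M[C]_(k * s)) : absorbed (M + M ^t*).
Proof.
have A0 : absorbed (0 : 'M[C]_(k * s)) by apply: sepsum_absorbed; exact: sepsum0.
have T (E : 'M[C]_k) (F : 'M[C]_s) : absorbed (E *t F + (E *t F) ^t*).
  have HE n (G : 'M[C]_n) : exists h1 h2 : 'M[C]_n,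
      [/\ h1 ^t* = h1, h2 ^t* = h2 & G = h1 + 'i *: h2].
    exists (2^-1 *: (G + G ^t*)), (2^-1 *: ('i *: (G ^t* - G))).
    have c2 : (2^-1)^* = 2^-1 :> C by rewrite (CrealP _)// rpredV realn.
    split.
    - by rewrite adjmxZ adjmxD trmxCK c2 addrC.
    - rewrite !adjmxZ adjmxD adjmxN trmxCK c2 conjCi.
      by apply/matrixP => i j; rewrite !mxE; ring.
    - apply/matrixP => i j; rewrite !mxE.
      have i2 : 'i * 'i = -1 :> C by rewrite -expr2 sqrCi.
      rewrite -[G i j in LHS]mul1r; transitivity (2^-1 * (G i j + (G j i)^*) +
        ('i * 'i) * 2^-1 * ((G j i)^* - G i j)); first by rewrite i2; field.
      by ring.
  have [h1 [h2 [hh1 hh2 ->]]] := HE _ E; have [g1 [g2 [gg1 gg2 ->]]] := HE _ F.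
  have -> : (h1 + 'i *: h2) *t (g1 + 'i *: g2) + ((h1 + 'i *: h2) *t (g1 + 'i *: g2)) ^t*
    = 2 *: (h1 *t g1 + (- (h2 *t g2))).
    rewrite adjmx_tens !adjmxD !adjmxZ hh1 hh2 gg1 gg2 conjCi.
    rewrite !tensDl !tensDr !tensZl !tensZr.
    have i2 : 'i * 'i = -1 :> C by rewrite -expr2 sqrCi.
    apply/matrixP => i j; rewrite !mxE.
    set x := h1 _ _ * _; set y := h2 _ _ * g2 _ _.
    set u := h1 _ _ * g2 _ _; set v := h2 _ _ * g1 _ _.
    transitivity (2 * x + 2 * ('i * 'i) * y); first by ring.
    by rewrite i2; ring.
  apply: absorbedZ => //; apply: absorbedD.
    by case: (absorbed_herm_tens hh1 gg1).
  by case: (absorbed_herm_tens hh2 gg2).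
have -> : M = \sum_(x : 'I_k * 'I_k) \sum_(y : 'I_s * 'I_s)
   (M (mxtens.mxtens_index (x.1, y.1)) (mxtens.mxtens_index (x.2, y.2))
     *: delta_mx x.1 x.2) *t delta_mx y.1 y.2.
  apply/matrixP => i j; case: (mxtens.mxtens_indexP i) => a b.
  case: (mxtens.mxtens_indexP j) => a' b'.
  rewrite summxE (bigD1 (a, a'))//= summxE (bigD1 (b, b'))//= mxtens.tensmxE !mxE !eqxx/=.
  rewrite !mulr1 big1 ?addr0 => [|[c c'] cc]; last first.
    rewrite mxtens.tensmxE !mxE -[b == _]/(((b, b').1 == (c, c').1)).
    by move: cc; rewrite xpair_eqE ![_ == b]eq_sym ![_ == b']eq_sym /= => /negbTE ->; rewrite mulr0.
  rewrite big1 ?addr0// => -[c c'] cc; rewrite summxE big1// => -[e e'] _.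
  rewrite mxtens.tensmxE !mxE.
  by move: cc; rewrite xpair_eqE ![_ == a]eq_sym ![_ == a']eq_sym /= => /negbTE ->; rewrite mulr0 mul0r.
elim/big_ind : _ => [|x y hx hy|x _].
- by rewrite trmx0 map_mx0 addr0.
- by rewrite adjmxD addrACA; exact: absorbedD.
elim/big_ind : _ => [|y z hx hy|y _].
- by rewrite trmx0 map_mx0 addr0.
- by rewrite adjmxD addrACA; exact: absorbedD.
exact: T.
Qed.

End Absorb.

(** * Dual witnesses of non-separability *)

Section Witness.
Context {R : realType}.
Local Notation C := (R[i]).
Local Notation "r %:C" := (real_complex R r) (at level 1, format "r %:C").

Lemma ge0_real_complex (c : C) : 0 <= c -> exists2 r : R, 0 <= r & c = r%:C.
Proof.
move=> c0; have /complex_realP[r cE] := ger0_real c0.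
by exists r; rewrite // -ler0c -cE.
Qed.

Lemma conj_real_complex (r : R) : (r%:C)^* = r%:C.
Proof. by rewrite (CrealP _)//; apply/complex_realP; exists r. Qed.

Definition dual_witness k s (W : 'M[C]_(k * s)) : Prop :=
  [/\ W ^t* = W, forall p b, psdmx p -> psdmx b -> 0 <= \tr (W *m (p *t b))
    & \tr W = 1].

Lemma entangled_witness k s (Z : 'M[C]_(k * s)) : Z ^t* = Z -> ~ sepsum Z ->
  exists2 W : 'M[C]_(k * s), dual_witness W & \tr (W *m Z) <= 0.
Proof.
move=> hZ nZ.
(* Testing the Hermitian part makes K a real cone in the whole matrix space. It contains every
   skew-Hermitian matrix with both signs, so the separating functional vanishes on those. *)
pose K : set 'M[C]_(k * s) := fun M => sepsum (M + M ^t*).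
have adj1 : (1%:M : 'M[C]_(k * s)) ^t* = 1%:M by rewrite adjmx_scalar conjC1.
have [] := @cone_separation R _ K 1%:M Z.
- by rewrite /K adj1; apply: sepsumD; exact: sepsum1.
- split=> [x y Kx Ky|r x r0 Kx].
    by rewrite /K adjmxD addrACA; exact: sepsumD.
  by rewrite /K adjmxZ conj_real_complex -scalerDr; apply: sepsumZ; rewrite // ler0c.
- move=> x; have [_ /ge0_real_complex[t _ ->] ht] := absorbed_adj x; exists (t / 2).
  rewrite /K adjmxD adjmxZ conj_real_complex adj1 addrACA -scalerDl -rmorphD.
  by rewrite -splitr.
- move=> h; apply: nZ; have -> : Z = (2^-1 : R)%:C *: (Z + Z ^t*).
    rewrite hZ; apply/matrixP => i j; rewrite !mxE fmorphV rmorph_nat.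
    by rewrite -mulr2n -[Z i j *+ 2]mulr_natl mulKf// pnatr_eq0.
  by apply: sepsumZ => //; rewrite ler0c invr_ge0.
move=> f [fD fZ fK f1 fZ0].
have f0 : f 0 = 0 by have := fD 0 0; rewrite addr0; lra.
have fN x : f (- x) = - f x by have := fD x (- x); rewrite subrr f0; lra.
have fanti M : M + M ^t* = 0 -> f M = 0.
  move=> h; have K1 : K M by rewrite /K h; exact: sepsum0.
  have K2 : K (- M) by rewrite /K adjmxN -opprD h oppr0; exact: sepsum0.
  by have := fK _ K1; have := fK _ K2; rewrite fN; lra.
have fadj M : f (M ^t*) = f M.
  have := fanti (M - M ^t*); rewrite fD fN adjmxD adjmxN trmxCK.
  by rewrite addrA subrK subrr => /(_ erefl); lra.
(* The complex-linear functional with real part f; it is then represented as a trace against W. *)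
pose L (M : 'M[C]_(k * s)) : C := (f M)%:C - 'i * (f ('i *: M))%:C.
have i2 : 'i * 'i = -1 :> C by rewrite -expr2 sqrCi.
have LD x y : L (x + y) = L x + L y.
  by rewrite /L scalerDr !fD !rmorphD /=; ring.
have LR r x : L (r%:C *: x) = r%:C * L x.
  by rewrite /L scalerA ['i * r%:C]mulrC -scalerA !fZ !rmorphM /=; ring.
have Li x : L ('i *: x) = 'i * L x.
  by rewrite /L scalerA i2 scaleN1r fN rmorphN /= mulrBr mulrA i2; ring.
have LZ c x : L (c *: x) = c * L x.
  rewrite [c]Crect -complexRe -complexIm scalerDl ['i * (complex.Im c)%:C]mulrC -scalerA.
  by rewrite LD !LR Li; ring.
have L0 : L 0 = 0 by rewrite -(scale0r 0) LZ mul0r.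
have Lsum I (r : seq I) (P : pred I) (F : I -> 'M[C]_(k * s)) :
    L (\sum_(i <- r | P i) F i) = \sum_(i <- r | P i) L (F i).
  exact: (big_morph L LD L0).
pose W : 'M[C]_(k * s) := \matrix_(i, j) L (delta_mx j i).
have WE M : \tr (W *m M) = L M.
  transitivity (\sum_i \sum_j W i j * M j i); first by apply: eq_bigr => i _; rewrite mxE.
  rewrite exchange_big [in RHS](matrix_sum_delta M) Lsum; apply: eq_bigr => i _.
  by rewrite Lsum; apply: eq_bigr => j _; rewrite mxE LZ mulrC.
have Lherm M : M ^t* = M -> L M = (f M)%:C.
  move=> hM; rewrite /L (fanti ('i *: M)) ?mulr0 ?subr0//.
  by rewrite adjmxZ hM conjCi scaleNr subrr.
have Lconj M : (L M)^* = L (M ^t*).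
  rewrite /L rmorphB rmorphM /= !conj_real_complex conjCi fadj mulNr.
  rewrite -[f ('i *: M)]fadj adjmxZ conjCi scaleNr fN rmorphN /=; ring.
exists W; last by rewrite WE Lherm// lecR.
split.
- by apply/matrixP => i j; rewrite !mxE Lconj trmx_delta map_delta_mx.
- move=> p b hp hb; rewrite WE Lherm ?ler0c.
    have hs := sepsum_tens hp hb.
    apply: fK; rewrite /K; have /hermsymmxP -> := (sepsum_psd hs).1.
    exact: sepsumD.
  by apply/hermsymmxP; exact: (tens_psd hp hb).1.
- by rewrite -[W]mulmx1 WE Lherm// f1.
Qed.

End Witness.

(** * Limits along an ultrafilter *)

Section UltraLimit.
Variables (U : set_system nat) (hU : UltraFilter U).

Definition ulim (C : numFieldType) (f : nat -> C) (l : C) : Prop :=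
  forall e, 0 < e -> U (fun q => `|f q - l| < e).

Section NumField.
Context {C : numFieldType}.
Implicit Types (f g : nat -> C) (l m : C).

Lemma ulim_cst l : ulim (fun=> l) l.
Proof. by move=> e e0; apply: filterE => q; rewrite subrr normr0. Qed.

Lemma eq_ulim f g l : f =1 g -> ulim f l -> ulim g l.
Proof. by move=> /funext ->. Qed.

Lemma ulimD f g l m : ulim f l -> ulim g m -> ulim (fun q => f q + g q) (l + m).
Proof.
move=> hf hg e e0; have e2 : 0 < e / 2 by rewrite divr_gt0.
apply: filterS (filterI (hf _ e2) (hg _ e2)) => q [h1 h2].
by rewrite opprD addrACA (splitr e) (le_lt_trans (ler_normD _ _))// ltrD.
Qed.

Lemma ulim0_le f g : (forall q, `|f q| <= `|g q|) -> ulim g 0 -> ulim f 0.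
Proof.
move=> fg hg e e0; apply: filterS (hg _ e0) => q; rewrite !subr0.
exact: le_lt_trans.
Qed.

Lemma ulim_sub0 f l : ulim f l <-> ulim (fun q => f q - l) 0.
Proof. by split=> h e e0; apply: filterS (h _ e0) => q; rewrite subr0. Qed.

Lemma ulim0Z b f : ulim f 0 -> ulim (fun q => b * f q) 0.
Proof.
move=> hf e e0; have b1 : 0 < `|b| + 1 by rewrite ltr_pwDr.
have eb : 0 < e / (`|b| + 1) by rewrite divr_gt0.
apply: filterS (hf _ eb) => q; rewrite !subr0 normrM ltr_pdivlMr// => h.
by rewrite (le_lt_trans _ h)// mulrC ler_wpM2l// lerDl.
Qed.

Lemma ulimN f l : ulim f l -> ulim (fun q => - f q) (- l).
Proof. by move=> h e e0; apply: filterS (h _ e0) => q; rewrite -opprD normrN. Qed.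

Lemma ulimZ b f l : ulim f l -> ulim (fun q => b * f q) (b * l).
Proof.
move=> /ulim_sub0/(ulim0Z b) h; apply/ulim_sub0.
by apply: eq_ulim h => q; rewrite mulrBr.
Qed.

Lemma ulimM f g l m : ulim f l -> ulim g m -> ulim (fun q => f q * g q) (l * m).
Proof.
move=> hf hg.
have h0 : ulim (fun q => (f q - l) * (g q - m)) 0.
  move=> e e0.
  have hf' := (ulim_sub0 _ _).1 hf _ e0; have hg' := (ulim_sub0 _ _).1 hg _ ltr01.
  apply: filterS (filterI hf' hg') => q [] /=; rewrite !subr0 normrM => h1 h2.
  by rewrite -[e]mulr1 ltr_pM.
have := ulimD (ulimD (ulimD h0 (ulimZ l hg)) (ulimZ m hf)) (ulim_cst (- (l * m))).
rewrite add0r [m * l]mulrC addrK; apply: eq_ulim => q.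
by ring.
Qed.

Lemma ulim_sum I (r : seq I) (P : pred I) (F : I -> nat -> C) (l : I -> C) :
  (forall i, P i -> ulim (F i) (l i)) ->
  ulim (fun q => \sum_(i <- r | P i) F i q) (\sum_(i <- r | P i) l i).
Proof.
move=> h; elim: r => [|i r IH].
  rewrite big_nil; apply: eq_ulim (ulim_cst 0) => q; by rewrite big_nil.
rewrite big_cons; case: ifPn => Pi.
  by apply: eq_ulim (ulimD (h _ Pi) IH) => q; rewrite big_cons Pi.
by apply: eq_ulim IH => q; rewrite big_cons (negbTE Pi).
Qed.

Lemma ulim_uniq f l m : ulim f l -> ulim f m -> l = m.
Proof.
move=> hl hm; apply/eqP; rewrite -subr_eq0 -normr_eq0; apply/negPn/negP => lm.
have e0 : 0 < `|l - m| / 2 by rewrite divr_gt0// lt_def lm /=.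
have [q [h1 h2]] : exists q, `|f q - l| < `|l - m| / 2 /\ `|f q - m| < `|l - m| / 2.
  by apply: (@filter_ex _ U); apply: filterS (filterI (hl _ e0) (hm _ e0)) => q [].
suff : `|l - m| < `|l - m| by rewrite ltxx.
rewrite [ltRHS](splitr `|l - m|) -{1}(subrKA (f q) l (- m)).
by rewrite (le_lt_trans (ler_normD _ _))// distrC ltrD.
Qed.

Lemma ulim_norm f l : ulim f l -> ulim (fun q => `|f q|) `|l|.
Proof.
move=> h e e0; apply: filterS (h _ e0) => q; apply: le_lt_trans.
exact: ler_dist_dist.
Qed.

Lemma ulim_ge0 f l : (forall q, 0 <= f q) -> ulim f l -> 0 <= l.
Proof.
move=> f0 h; have := ulim_norm h; have -> : (fun q => `|f q|) = f.
  by apply/funext => q; rewrite ger0_norm.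
by move=> /(ulim_uniq h) ->.
Qed.

Lemma ulim0_sqr f : ulim (fun q => `|f q| ^+ 2) 0 -> ulim f 0.
Proof.
move=> h e e0; have e2 : 0 < e ^+ 2 by rewrite exprn_gt0.
apply: filterS (h _ e2) => q; rewrite !subr0 ger0_norm ?exprn_ge0//.
by rewrite ltr_pXn2r ?nnegrE// ltW.
Qed.

Lemma ulim_poly (p : {poly C}) f : ulim f 0 -> ulim (fun q => p.[f q]) p`_0.
Proof.
move=> hf; elim/poly_ind: p => [|p c IH].
  by rewrite coef0; apply: eq_ulim (ulim_cst 0) => q; rewrite horner0.
have := ulimD (ulimM IH hf) (ulim_cst c).
rewrite mulr0 add0r coefD coefMX coefC /= add0r.
by apply: eq_ulim => q; rewrite !hornerE.
Qed.

End NumField.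

Lemma ulim_conj (C : numClosedFieldType) (f : nat -> C) l :
  ulim f l -> ulim (fun q => (f q)^*) l^*.
Proof. by move=> h e e0; apply: filterS (h _ e0) => q; rewrite -rmorphB norm_conjC. Qed.

Section Real.
Context {R : realType}.

(** The limit is the supremum of the levels a such that [a <= f q] holds on a set of the
    ultrafilter; above that level the ultrafilter must contain the complement. *)
Lemma bounded_ulim_real (f : nat -> R) b : (forall q, `|f q| <= b) ->
  exists l, ulim f l.
Proof.
move=> fb; pose S : set R := fun a => U (fun q => a <= f q).
have supS : has_sup S.
  split.
    by exists (- b); apply: filterE => q; have := fb q; rewrite ler_norml => /andP[].
  exists b => a Sa; have [q aq] := filter_ex Sa; apply: (le_trans aq).
  by have := fb q; rewrite ler_norml => /andP[].
exists (sup S) => e e0.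
have h1 : U (fun q => sup S - e < f q).
  have /(sup_gt supS.1)[a Sa] : sup S - e < sup S by rewrite ltrBlDr ltrDl.
  move=> ea; apply: filterS (Sa : U (fun q => a <= f q)) => q; exact: lt_le_trans.
have h2 : U (fun q => f q < sup S + e).
  have [h|] := in_ultra_setVsetC (fun q => sup S + e / 2 <= f q) hU.
    have := ub_le_sup supS.2 h; lra.
  apply: filterS => q /negP; rewrite -ltNge => /lt_trans; apply; lra.
apply: filterS (filterI h1 h2) => q [h3 h4]; rewrite ltr_norml; apply/andP; split; lra.
Qed.

End Real.
End UltraLimit.

(** * Coefficient relations of the limit pencil *)

Section Relations.
Context {C : numClosedFieldType}.
Variables (n : nat) (a b d : nat -> nat -> C) (sl : nat -> C).
Hypothesis a_out : forall i j, (n < j)%N -> a i j = 0.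
Hypothesis b_out : forall i j, (n < i)%N || (n < j)%N -> b i j = 0.
Hypothesis d_out : forall i j, (n < j)%N -> d i j = 0.
Hypothesis a_herm : forall i j, (a i j)^* = a j i.
Hypothesis d_herm : forall i j, (d i j)^* = d j i.
Hypothesis sl_real : forall j, sl j \is Num.real.
Hypothesis b0 : forall i, b 0 i = 0.
(* [rel0] and [rel1] are the coefficients of [zeta ^+ j] and [t * zeta ^+ j] in row i
   of [pencil A B D (zeta * (1 + t)) *m zero_vector K zeta t] for unit [zeta]; here
   [sl j] is the coefficient of order 1 of [weight K j]. *)
Hypothesis rel0 : forall i j,
  a i j + d i j + (if j is j'.+1 then b i j' else 0) + (b j.+1 i)^* = 0.
Hypothesis rel1 : forall i j,
  sl j * a i j + (2 + sl j) * d i j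
  + (if j is j'.+1 then (1 + sl j') * b i j' else 0) + (1 + sl j.+1) * (b j.+1 i)^* = 0.

(** The off-diagonal block, negated and shifted by one column, so that row and column index the same
    edge. Likewise [incr j.+1] is the slope of the edge from j to [j.+1]. *)
Definition kap i j : C := if j is j'.+1 then - b i j' else 0.
Definition incr j : C := if j is j'.+1 then sl j - sl j' else 0.

Arguments kap : simpl never.
Arguments incr : simpl never.

Lemma kap0l j : kap 0 j = 0.
Proof. by case: j => //= j; rewrite /kap b0 oppr0. Qed.

Lemma offdiag_kap i j : b i j = - kap i j.+1.
Proof. by rewrite /kap opprK. Qed.

Lemma incr_conj j : (incr j)^* = incr j.
Proof. by apply/CrealP; case: j => [|j]; rewrite ?rpred0// rpredB. Qed.

Lemma kap_add i j : a i j + d i j = kap i j + (kap j.+1 i.+1)^*.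
Proof.
apply/eqP; rewrite -subr_eq0 -[X in _ == X](rel0 i j); apply/eqP.
by rewrite /kap; case: j => [|j] /=; rewrite ?rmorphN /=; ring.
Qed.

(** Induction along the diagonal: by [kap_add], the Hermitian array a + d ties the entry at (i, j)
    to the one at (i.+1, j.+1), starting from the zero first row and column. *)
Lemma kap_herm i j : (kap i j)^* = kap j i.
Proof.
elim: i j => [|i IH] [|j]; rewrite ?kap0l ?conjC0//.
have h : (a j i + d j i)^* = a i j + d i j by rewrite rmorphD /= a_herm d_herm.
by move: h; rewrite !kap_add rmorphD /= conjCK -(IH j) conjCK => /addrI ->; rewrite conjCK.
Qed.

Lemma kap_out i : kap i n.+1 = 0.
Proof.
have := rel0 i n.+1; rewrite a_out// d_out// (@b_out n.+2) ?conjC0.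
  by rewrite add0r add0r addr0 /kap => ->; rewrite oppr0.
by rewrite ltnW.
Qed.

Lemma kap_add_sym i j : a i j + d i j = kap i j + kap i.+1 j.+1.
Proof. by rewrite kap_add kap_herm. Qed.

(** Subtract [1 + sl j] times the zeroth-order relation from the first-order one. *)
Lemma kap_sub i j : d i j - a i j = incr j.+1 * kap i.+1 j.+1 - incr j * kap i j.
Proof.
have h := rel1 i j; have h0' := congr1 ( *%R (1 + sl j)) (rel0 i j); rewrite mulr0 in h0'.
have -> : kap i.+1 j.+1 = - (b j.+1 i)^* by rewrite -kap_herm /kap rmorphN.
apply/eqP; rewrite -subr_eq0; apply/eqP; rewrite -(subrr 0) -[X in _ = X - _]h.
rewrite -[X in _ = _ - X]h0'.
by rewrite /kap /incr; case: j {h h0'} => [|j] /=; ring.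
Qed.

(** The same diagonal induction, now applied to the Hermitian array d - a. Consequently [kap]
    vanishes between edges of different slope. *)
Lemma incr_kap i j : incr i * kap i j = incr j * kap i j.
Proof.
elim: i j => [|i IH] [|j]; rewrite ?kap0l ?mulr0//.
have h : (d j i - a j i)^* = d i j - a i j by rewrite rmorphB /= d_herm a_herm.
move: h; rewrite !kap_sub rmorphB !rmorphM /= !kap_herm !incr_conj IH.
by move=> /addIr.
Qed.

(* [c j] and [e j] are the two edge differences of the test vector. *)
Lemma row_pencil (z : C) (y : nat -> C) i :
  let c j := z * y j - y j.+1 in let e j := y j - z * y j.+1 in
  \sum_(j < n.+1) (a i j + z * b i j + z * (b j i)^* + z ^+ 2 * d i j) * y j =
  \sum_(j < n) (2^-1 * (kap i.+1 j.+1 * (z * ((1 + incr j.+1) * c j) + (1 - incr j.+1) * e j)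
      - kap i j.+1 * ((1 + incr j.+1) * c j + z * ((1 - incr j.+1) * e j)))).
Proof.
move=> c e.
(* Once a, b and d are expressed through [kap], this is a summation by parts: P and T shift by one
   index, with boundary terms zero because [kap] vanishes in columns 0 and n.+1. *)
pose P j := kap i j * (2^-1 * ((1 + incr j) + z ^+ 2 * (1 - incr j)) * y j).
pose Q j := kap i.+1 j.+1 * (2^-1 * ((1 - incr j.+1) + z ^+ 2 * (1 + incr j.+1)) * y j).
pose S j := kap i j.+1 * (z * y j).
pose T j := kap i.+1 j * (z * y j).
transitivity (\sum_(j < n.+1) (P j + Q j - S j - T j)).
  apply: eq_bigr => j _.
  have h1 := kap_add_sym i j; have h2 := kap_sub i j.
  rewrite (_ : a i j = 2^-1 * (kap i j + kap i.+1 j.+1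
    - (incr j.+1 * kap i.+1 j.+1 - incr j * kap i j))); last by rewrite -h1 -h2; field.
  rewrite (_ : d i j = 2^-1 * (kap i j + kap i.+1 j.+1
    + (incr j.+1 * kap i.+1 j.+1 - incr j * kap i j))); last by rewrite -h1 -h2; field.
  have -> : (b j i)^* = - kap i.+1 j by rewrite offdiag_kap rmorphN /= kap_herm.
  rewrite offdiag_kap /P /Q /S /T.
  by ring.
rewrite !sumrB big_split /=.
rewrite [\sum_(j < n.+1) P j]big_ord_recl [\sum_(j < n.+1) T j]big_ord_recl.
rewrite [\sum_(j < n.+1) Q j]big_ord_recr [\sum_(j < n.+1) S j]big_ord_recr /=.
rewrite {1}/P {2}/Q {2}/S {1}/T !kap_out /= !mul0r !add0r !addr0.
rewrite -big_split -!sumrB; apply: eq_bigr => j _ /=.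
rewrite /P /Q /S /T /c /e /bump /= !add1n.
by field.
Qed.

(** The hypotheses remove every edge contribution except the [e m] term. Since m is the only edge of
    slope 2, column m.+1 of [kap] has just its diagonal entry, which meets rows m and m.+1 and
    reassembles the conjugate of [e m]. *)
Lemma pencil_edge (m : nat) (z : C) (y : nat -> C) :
  let c j := z * y j - y j.+1 in let e j := y j - z * y j.+1 in
  (m < n)%N -> z \is Num.real -> incr m.+1 = 2 ->
  (forall i, (i <= n)%N -> i != m.+1 -> incr i != 2) ->
  (forall i, \sum_(j < n) kap i j.+1 * ((1 + incr j.+1) * c j) = 0) ->
  (forall j, (j < n)%N -> j != m -> (1 - incr j.+1) * e j = 0) ->
  \sum_(i < n.+1) (y i)^* *
    (\sum_(j < n.+1) (a i j + z * b i j + z * (b j i)^* + z ^+ 2 * d i j) * y j)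
  = - (2^-1 * kap m.+1 m.+1 * (e m * (e m)^*)).
Proof.
move=> c e mn zR im ni hc he.
have kN i : i != m.+1 -> kap i m.+1 = 0.
  move=> im1; have [i_n|ni_n] := leqP i n; last by rewrite /kap b_out ?oppr0// ni_n.
  have := incr_kap i m.+1; rewrite im => /eqP; rewrite -subr_eq0 -mulrBl mulf_eq0.
  by rewrite subr_eq0 (negbTE (ni _ _ _))// => /eqP.
have row i : \sum_(j < n.+1) (a i j + z * b i j + z * (b j i)^* + z ^+ 2 * d i j) * y j
    = 2^-1 * e m * (z * kap i m.+1 - kap i.+1 m.+1).
  rewrite row_pencil -mulr_sumr.
  rewrite (eq_bigr (fun j : 'I_n => z * (kap i.+1 j.+1 * ((1 + incr j.+1) * c j))
      - kap i j.+1 * ((1 + incr j.+1) * c j)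
      + (kap i.+1 j.+1 - z * kap i j.+1) * ((1 - incr j.+1) * e j))); last first.
    by move=> j _; rewrite /c /e; ring.
  rewrite big_split sumrB /= -mulr_sumr !hc mulr0 subrr add0r.
  rewrite (bigD1 (Ordinal mn))//= big1 ?addr0; last first.
    by move=> j jm; rewrite he ?mulr0//; move: jm; rewrite -val_eqE.
  by rewrite im; ring.
under eq_bigr => i _ do rewrite row.
have mn1 : (m < n.+1)%N by rewrite ltnW.
rewrite (eq_bigr (fun i : 'I_n.+1 => 2^-1 * e m * z * ((y i)^* * kap i m.+1)
   - 2^-1 * e m * ((y i)^* * kap i.+1 m.+1))); last by move=> i _; ring.
rewrite sumrB -!mulr_sumr.
have mn2 : (m.+1 < n.+1)%N by [].
rewrite (bigD1 (Ordinal mn2))//= big1 ?addr0; last first.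
  by move=> i; rewrite -val_eqE /= => /kN ->; rewrite mulr0.
rewrite (bigD1 (Ordinal mn1))//= big1 ?addr0; last first.
  by move=> i; rewrite -val_eqE /= => im1; rewrite kN ?mulr0.
rewrite /e rmorphB rmorphM /= (CrealP zR); ring.
Qed.

End Relations.

(** * The chain and its test vector *)

Definition nedges (K : nat) := (K + K.+1).+2.

(* The end slopes 1/2 and the middle slope 2 make the second-order term in t of
   [chain_witness] vanish at the zero vectors, and they single out the middle edge,
   the only one of slope 2. *)
Definition slope (C : numClosedFieldType) (K j : nat) : C :=
  if (j == 0%N) || (j == (K + K.+1).+1) then 2^-1 else if j == K.+1 then 2 else 1.

Section Chain.
Context {C : numClosedFieldType}.
Variable K : nat.

(** The layout of the chain: left end edge, K edges of slope 1, middle edge, K edges of slope 1,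
    right end edge. *)
Lemma sum_edges (f : nat -> C) : \sum_(j < nedges K) f j =
  f 0%N + \sum_(t < K) f t.+1 + f K.+1 + \sum_(t < K) f (K.+2 + t)%N + f (K + K.+1).+1.
Proof.
rewrite /nedges big_ord_recl big_ord_recr /= /bump /= add1n.
rewrite big_split_ord /= big_ord_recl /= !addn0 !add1n !addrA.
by congr (_ + _ + _ + _ + _); apply: eq_bigr => t _; congr f; rewrite /= /bump /=; lia.
Qed.

(** Inverts the difference [z * y j - y j.+1]: the site vector starting at 0 with prescribed edge
    differences c. *)
Definition walk (z : C) (c : nat -> C) :=
  fix y (j : nat) : C := if j is j'.+1 then z * y j' - c j' else 0.

Lemma walkD z c i t : walk z c (i + t)%N =
  z ^+ t * walk z c i - \sum_(u < t) z ^+ (t - u.+1) * c (i + u)%N.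
Proof.
elim: t => [|t IH]; first by rewrite addn0 expr0 mul1r big_ord0 subr0.
rewrite addnS /= IH big_ord_recr /= subnn expr0 mul1r exprS mulrBr mulrA opprD addrA.
congr (_ - _ - _); rewrite mulr_sumr; apply: eq_bigr => u _.
by rewrite mulrA -exprS subSS subnSK.
Qed.

(** Supplies a real point z at least 2, so that both end values are nonzero and z squared differs
    from 1. *)
Lemma poly_nonroot (p : {poly C}) : p != 0 -> exists N : nat, p.[N.+2%:R] != 0.
Proof.
move=> p0; apply: contrapT => h.
pose rs := [seq (N.+2%:R : C) | N <- iota 0 (size p)].
have := max_poly_roots p0 (rs := rs); rewrite size_map size_iota ltnn.
have -> : all (root p) rs.
  apply/allP => _ /mapP[N _ ->]; apply/negPn/negP => hN; by apply: h; exists N.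
suff -> : uniq rs by move=> /(_ isT isT).
rewrite map_inj_uniq ?iota_uniq// => i j /eqP; rewrite eqr_nat => /eqP[]//.
Qed.

Section TestVector.
Variables (cL cR : nat -> C) (z : C).

(* The kernel vectors on the two halves are scaled so that the walk returns to 0
   at the right end. *)
Definition end_value (c : nat -> C) : C := \sum_(t < K) z ^+ (K - t.+1) * c t.

Definition test_edge (j : nat) : C :=
  if (0 < j <= K)%N then end_value cR * cL j.-1
  else if (K.+2 <= j < K.+2 + K)%N then - (z ^+ K.+1 * end_value cL) * cR (j - K.+2)%N
  else 0.

Local Notation y := (walk z test_edge).

Lemma test_edge0 : [/\ test_edge 0 = 0, test_edge K.+1 = 0 & test_edge (K + K.+1).+1 = 0].
Proof.
have h1 : (K.+1 <= K)%N = false by lia.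
have h2 : ((K + K.+1).+1 <= K)%N = false by lia.
have h3 : ((K + K.+1).+1 < K.+2 + K)%N = false by lia.
have h4 : (K.+1 < K.+1)%N = false by lia.
by rewrite /test_edge h1 h2 h3 h4 /= andbF; split.
Qed.

Lemma test_edgeL t : (t < K)%N -> test_edge t.+1 = end_value cR * cL t.
Proof. by move=> tK; rewrite /test_edge tK. Qed.

Lemma test_edgeR t : (t < K)%N ->
  test_edge (K.+2 + t)%N = - (z ^+ K.+1 * end_value cL) * cR t.
Proof.
move=> tK; have h : (K.+2 + t <= K)%N = false by lia.
by rewrite /test_edge h andbF leq_addr ltn_add2l tK addKn.
Qed.

Lemma walk1 : y 1 = 0.
Proof. by have [h _ _] := test_edge0; rewrite /= h subr0 mulr0. Qed.

Lemma walk_mid : y K.+1 = - (end_value cR * end_value cL).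
Proof.
rewrite -add1n walkD walk1 mulr0 sub0r; congr (- _).
rewrite mulr_sumr; apply: eq_bigr => t _.
by rewrite add1n test_edgeL// mulrCA.
Qed.

Lemma walk_mid1 : y K.+2 = z * y K.+1.
Proof. by have [_ h _] := test_edge0; rewrite /= -/(walk _ _ K.+1) h subr0. Qed.

Lemma walk_end : y (K + K.+1).+1 = 0.
Proof.
have -> : (K + K.+1).+1 = (K.+2 + K)%N by lia.
rewrite walkD walk_mid1 walk_mid.
rewrite (eq_bigr (fun t : 'I_K => - (z ^+ K.+1 * end_value cL) * (z ^+ (K - t.+1) * cR t))).
  by rewrite -mulr_sumr -/(end_value cR) exprS; ring.
by move=> t _; rewrite test_edgeR// mulrCA.
Qed.

Lemma walk_end1 : y (nedges K) = 0.
Proof.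
have [_ _ h] := test_edge0.
by rewrite /nedges [LHS]/= -/(walk _ _ (K + K.+1).+1) walk_end h mulr0 subr0.
Qed.

End TestVector.

End Chain.

(** * The sign of the middle coefficient *)

Section LimitContradiction.
Context {C : numClosedFieldType}.
Variables (K : nat) (a b d : nat -> nat -> C) (sl : nat -> C).
Local Notation n := (nedges K).
Hypothesis a_out : forall i j, (n < j)%N -> a i j = 0.
Hypothesis b_out : forall i j, (n < i)%N || (n < j)%N -> b i j = 0.
Hypothesis d_out : forall i j, (n < j)%N -> d i j = 0.
Hypothesis a_herm : forall i j, (a i j)^* = a j i.
Hypothesis d_herm : forall i j, (d i j)^* = d j i.
Hypothesis sl_real : forall j, sl j \is Num.real.
Hypothesis b0 : forall i, b 0 i = 0.
Hypothesis rel0 : forall i j,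
  a i j + d i j + (if j is j'.+1 then b i j' else 0) + (b j.+1 i)^* = 0.
Hypothesis rel1 : forall i j,
  sl j * a i j + (2 + sl j) * d i j
  + (if j is j'.+1 then (1 + sl j') * b i j' else 0) + (1 + sl j.+1) * (b j.+1 i)^* = 0.
Hypothesis slE : forall j, (j < n)%N -> sl j.+1 - sl j = slope C K j.
Variables cL cR : nat -> C.
Hypothesis cL0 : exists2 t, (t < K)%N & cL t != 0.
Hypothesis cR0 : exists2 t, (t < K)%N & cR t != 0.
Hypothesis hL : forall i, \sum_(t < K) b i t.+1 * cL t = 0.
Hypothesis hR : forall i, \sum_(t < K) b i (K.+2 + t)%N * cR t = 0.
Hypothesis pos : forall z (y : nat -> C), z \is Num.real ->
  0 <= \sum_(i < n.+1) (y i)^* *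
    (\sum_(j < n.+1) (a i j + z * b i j + z * (b j i)^* + z ^+ 2 * d i j) * y j).

Let rpoly (c : nat -> C) : {poly C} := \poly_(u < K) c (K - u.+1)%N.

Lemma end_valueE z c : end_value K z c = (rpoly c).[z].
Proof.
rewrite /rpoly horner_poly (reindex_inj rev_ord_inj) /=; apply: eq_bigr => t _.
by rewrite mulrC; congr (c _ * _); have := ltn_ord t; rewrite /=; lia.
Qed.

Lemma rpoly_neq0 c : (exists2 t, (t < K)%N & c t != 0) -> rpoly c != 0.
Proof.
move=> [t tK]; apply: contraNneq => /(congr1 (fun p : {poly C} => p`_(K - t.+1))).
rewrite coef_poly coef0 ifT; last by lia.
by move=> h; rewrite -[X in _ == X]h; apply/eqP; congr c; lia.
Qed.

(** On the test walk the c-differences are killed by the kernel vectors, since the slope is constant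
    on each half. The e-differences are killed by slope 1 inside the halves and by zero endpoint
    values at both ends. Only the middle edge remains, so the form is a positive multiple of
    [b K.+2 K.+1]. *)
Lemma mid_coef_ge0 : 0 <= b K.+2 K.+1.
Proof.
have := mulf_neq0 (rpoly_neq0 cL0) (rpoly_neq0 cR0).
move=> /poly_nonroot[N]; rewrite hornerM mulf_eq0 negb_or -!end_valueE.
set z := N.+2%:R => /andP[zL zR].
have zr : z \is Num.real by rewrite realn.
pose y := walk z (test_edge K cL cR z).
have yS j : z * y j - y j.+1 = test_edge K cL cR z j by rewrite /y /= subKr.
have incrS j : (j < n)%N -> incr sl j.+1 = slope C K j by exact: slE.
have s2 : slope C K K.+1 = 2.
  by rewrite /slope eqxx ifF//; apply/negbTE; rewrite negb_or /=; lia.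
have s1 t : (t < K)%N -> slope C K t.+1 = 1 /\ slope C K (K.+2 + t)%N = 1.
  by move=> tK; rewrite /slope !ifF//; lia.
have mn : (K.+1 < n)%N by rewrite /nedges; lia.
have neq2 i : (i <= n)%N -> i != K.+2 -> incr sl i != 2.
  case: i => [_ _|i i_n iK]; first by rewrite /incr eq_sym pnatr_eq0.
  rewrite incrS// /slope; case: ifP => _.
    apply/eqP => /(congr1 ( *%R 2)); rewrite mulfV ?pnatr_eq0// -natrM => /eqP.
    by rewrite eq_sym -[1]/(1%:R) eqr_nat.
  by rewrite (negbTE (iK : i != K.+1)) eq_sym -[1]/(1%:R) eqr_nat.
have k0 i : \sum_(j < n) kap b i j.+1 * ((1 + incr sl j.+1) * (z * y j - y j.+1)) = 0.
  pose f j := kap b i j.+1 * ((1 + incr sl j.+1) * (z * y j - y j.+1)).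
  have [e0 e1 e2] := test_edge0 K cL cR z.
  rewrite (@sum_edges _ K f) /f ?yS ?e0 ?e1 ?e2 ?mulr0 add0r !addr0.
  rewrite (eq_bigr (fun t : 'I_K => - (2 * end_value K z cR) * (b i t.+1 * cL t))).
    rewrite -mulr_sumr hL mulr0 add0r.
    rewrite (eq_bigr (fun t : 'I_K =>
       2 * (z ^+ K.+1 * end_value K z cL) * (b i (K.+2 + t)%N * cR t))).
      by rewrite -mulr_sumr hR mulr0.
    move=> t _; rewrite yS incrS; last by have := ltn_ord t; rewrite /nedges; lia.
    by rewrite (s1 t _).2// test_edgeR// /kap; ring.
  move=> t _; rewrite yS incrS; last by have := ltn_ord t; rewrite /nedges; lia.
  by rewrite (s1 t _).1// test_edgeL// /kap; ring.
have e0 j : (j < n)%N -> j != K.+1 -> (1 - incr sl j.+1) * (y j - z * y j.+1) = 0.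
  move=> jn jK; rewrite incrS// /slope (negbTE jK).
  case: ifP => [/orP[/eqP->|/eqP->]|_]; last by rewrite subrr mul0r.
    by rewrite /y walk1 /= mulr0 subr0 mulr0.
  by rewrite /y walk_end -/(nedges K) walk_end1 mulr0 subr0 mulr0.
have im : incr sl K.+2 = 2 by rewrite incrS.
have := pos y zr.
rewrite (@pencil_edge _ n a b d sl a_out b_out d_out a_herm d_herm sl_real b0 rel0 rel1
   K.+1 z y mn zr im neq2 k0 e0).
set e := y K.+1 - _.
(* Here e equals 1 - z^2 times the middle value of the walk, which is minus the product of the two
   end values. *)
have eN0 : e != 0.
  rewrite /e /y walk_mid1 walk_mid mulrA -[X in X - _]mul1r -mulrBl.
  rewrite mulf_neq0 ?oppr_eq0 ?mulf_neq0// subr_eq0 -natrM eq_sym -[1]/(1%:R) eqr_nat.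
  by [].
rewrite /kap mulrN mulNr opprK pmulr_lge0; last by rewrite lt_def mul_conjC_ge0 mul_conjC_eq0 eN0.
by rewrite pmulr_rge0// invr_gt0.
Qed.

End LimitContradiction.

(** * Trigonometric polynomials, rows of semidefinite matrices, kernel vectors *)

Section Algebra.
Context {C : numClosedFieldType}.

(** After multiplication by [zeta i] the sum is the value of a polynomial of degree at most s.+1,
    and it has s.+2 distinct roots; the conclusion lists its coefficients. *)
Lemma trig_vanish (s : nat) (zeta f g h : nat -> C) :
  injective zeta -> (forall i, zeta i != 0) ->
  (forall j, (s <= j)%N -> [/\ f j = 0, g j = 0 & h j = 0]) ->
  (forall i, (i < s.+2)%N ->
     \sum_(j < s) zeta i ^+ j * (f j + zeta i * g j + (zeta i)^-1 * h j) = 0) ->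
  h 0%N = 0 /\ forall j, f j + (if j is j'.+1 then g j' else 0) + h j.+1 = 0.
Proof.
move=> zinj z0 out hz.
pose pf := \poly_(j < s) f j; pose pg := \poly_(j < s) g j; pose ph := \poly_(j < s) h j.
pose Q := 'X * pf + 'X^2 * pg + ph.
have szQ : (size Q <= s.+2)%N.
  have := size_polyD ('X * pf + 'X^2 * pg) ph; have := size_polyD ('X * pf) ('X^2 * pg).
  have := size_polyMleq 'X pf; have := size_polyMleq 'X^2 pg.
  rewrite size_polyX size_polyXn -/Q.
  have := size_poly s f; have := size_poly s g; have := size_poly s h.
  rewrite -/pf -/pg -/ph.
  move: (size pf) (size pg) (size ph) (size ('X * pf)) (size ('X^2 * pg)) (size Q)
    (size ('X * pf + 'X^2 * pg)); lia.
have Q0 : Q = 0.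
  apply: (@roots_geq_poly_eq0 _ _ [seq zeta i | i <- iota 0 s.+2]).
  - apply/allP => _ /mapP[i + ->]; rewrite mem_iota add0n => /andP[_ /hz h0].
    rewrite rootE /Q !hornerE /pf /pg /ph !horner_poly !mulr_sumr -!big_split /=.
    apply/eqP; transitivity (zeta i * 0); last exact: mulr0.
    rewrite -[X in _ = _ * X]h0 mulr_sumr.
    by apply: eq_bigr => j _; field; exact: z0.
  - by rewrite map_inj_uniq ?iota_uniq.
  - by rewrite size_map size_iota.
have coefp u j : (forall j, (s <= j)%N -> u j = 0) ->
    (\poly_(j < s) u j)`_j = u j :> C.
  by move=> u0; rewrite coef_poly; case: ltnP => // /u0.
have cf := coefp f _ (fun j hj => let: And3 x _ _ := out j hj in x).
have cg := coefp g _ (fun j hj => let: And3 _ x _ := out j hj in x).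
have ch := coefp h _ (fun j hj => let: And3 _ _ x := out j hj in x).
have cQ j : Q`_j = 0 by rewrite Q0 coef0.
split.
  by have := cQ 0%N; rewrite /Q !coefD coefXM coefXnM /= !add0r ch.
move=> j; have := cQ j.+1; rewrite /Q !coefD coefXM coefXnM /= cf ch.
by case: j => [|j] /=; rewrite ?subn1 ?subSS ?subn0 ?cg.
Qed.

Lemma herm_qform_real n (H : 'M[C]_n) v : H ^t* = H -> (qform H v)^* = qform H v.
Proof.
move=> hH; rewrite /qform.
have -> : ((v ^t* *m H *m v) 0 0)^* = ((v ^t* *m H *m v) ^t*) 0 0 by rewrite !mxE.
by rewrite !adjmx_mul trmxCK hH mulmxA.
Qed.

(** Evaluate the form at y moved along the l-th basis vector. The step is divided by [H l l + 1]
    rather than [H l l], which may be zero. This turns a small value of the form into small rows. *)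
Lemma psd_mulmx_bound n (H : 'M[C]_n) (y : 'cV[C]_n) l :
  H ^t* = H -> (forall v, 0 <= qform H v) ->
  `|(H *m y) l 0| ^+ 2 <= (H l l + 1) ^+ 2 * qform H y.
Proof.
move=> hH pH; set h := (H *m y) l 0; set g := H l l.
pose dl : 'cV[C]_n := delta_mx l 0.
have adl : dl ^t* = delta_mx 0 l by rewrite trmx_delta map_delta_mx.
have qdl : qform H dl = g.
  by rewrite /qform adl -rowE mxE (bigD1 l)//= big1 ?addr0 => [|j jl];
     rewrite !mxE ?eqxx ?mulr1// (negbTE jl) mulr0.
have g0 : 0 <= g by rewrite -qdl.
have exp c : qform H (y + c *: dl) = qform H y + c^* * h + c * h^* + c * c^* * g.
  have e1 : (dl ^t* *m H *m y) 0 0 = h.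
    by rewrite adl -mulmxA -rowE mxE.
  have e2 : (y ^t* *m H *m dl) 0 0 = h^*.
    rewrite -e1; have -> : ((dl ^t* *m H *m y) 0 0)^* = ((dl ^t* *m H *m y) ^t*) 0 0.
      by rewrite !mxE.
    by rewrite !adjmx_mul trmxCK hH mulmxA.
  rewrite -qdl /qform adjmxD adjmxZ !mulmxDl !mulmxDr -!scalemxAl -!scalemxAr.
  have aE (M N : 'M[C]_1) : (M + N) 0 0 = M 0 0 + N 0 0 by rewrite mxE.
  have zE x (M : 'M[C]_1) : (x *: M) 0 0 = x * M 0 0 by rewrite mxE.
  by rewrite !(aE, zE) e1 e2; ring.
have g1 : 0 < g + 1 by rewrite ltr_pwDr.
have := pH (y + (- (h / (g + 1))) *: dl).
rewrite exp rmorphN fmorph_div /= [(g + 1)^*](CrealP _) ?ger0_real ?(ltW g1)//.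
set qf := qform H y.
have -> : qf + - (h^* / (g + 1)) * h + - (h / (g + 1)) * h^*
   + - (h / (g + 1)) * - (h^* / (g + 1)) * g
   = ((g + 1) ^+ 2 * qf - (g + 2) * (h * h^*)) / (g + 1) ^+ 2.
  by have := lt0r_neq0 g1 => g1'; field.
rewrite pmulr_lge0 ?invr_gt0 ?exprn_gt0// subr_ge0 => hle.
rewrite normCK (le_trans _ hle)// ler_peMl ?mul_conjC_ge0//.
by rewrite ler_wpDl// ler1n.
Qed.

(** K columns of B are dependent. The kernel vector is normalized so that a limit of such vectors
    stays nonzero. *)
Lemma rank_kernel s K (B : 'M[C]_s) (f : 'I_K -> 'I_s) : (\rank B < K)%N ->
  exists2 c : 'cV[C]_K, \sum_t c t 0 * (c t 0)^* = 1
    & forall i, \sum_t B i (f t) * c t 0 = 0.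
Proof.
move=> rB; pose N := (colsub f B)^T.
have rN : (\rank N < K)%N.
  rewrite mxrank_tr (leq_ltn_trans _ rB)//.
  have -> : colsub f B = B *m colsub f 1%:M by rewrite mulmx_colsub mulmx1.
  exact: mxrankM_maxl.
have kN : kermx N != 0 by rewrite -mxrank_eq0 mxrank_ker -lt0n subn_gt0.
pose u := nz_row (kermx N).
have u0 : u != 0 by rewrite nz_row_eq0.
have uN : u *m N = 0.
  by apply/sub_kermxP; exact: nz_row_sub.
pose S := \sum_t u 0 t * (u 0 t)^*.
have S0 : 0 < S.
  rewrite lt_def sumr_ge0 ?andbT => [|t _]; last exact: mul_conjC_ge0.
  apply: contraNneq u0 => /psumr_eq0P h; apply/eqP/rowP => t; rewrite mxE.
  by apply/eqP; rewrite -mul_conjC_eq0 h// => j _; exact: mul_conjC_ge0.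
have sS : sqrtC S != 0 by rewrite sqrtC_eq0 gt_eqF.
exists ((sqrtC S)^-1 *: u^T).
  rewrite (eq_bigr (fun t => ((sqrtC S)^-1 * ((sqrtC S)^-1)^*) * (u 0 t * (u 0 t)^*))).
    rewrite -mulr_sumr -/S fmorphV /= [(sqrtC S)^*](CrealP _); last first.
      by rewrite ger0_real// sqrtC_ge0 ltW.
    by rewrite -invfM -expr2 sqrtCK mulVf// gt_eqF.
  by move=> t _; rewrite !mxE rmorphM /=; ring.
move=> i; rewrite (eq_bigr (fun t => (sqrtC S)^-1 * (u 0 t * N t i))); last first.
  by move=> t _; rewrite !mxE; ring.
by rewrite -mulr_sumr; have /rowP/(_ i) := uN; rewrite mxE => ->; rewrite mxE mulr0.
Qed.

End Algebra.

Section Weights.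
Context {C : numClosedFieldType}.
Variable K : nat.

Definition weight (j : nat) : {poly C} := \prod_(i < j) (1 + slope C K i *: 'X).

Lemma weightS j : weight j.+1 = weight j * (1 + slope C K j *: 'X).
Proof. by rewrite /weight big_ord_recr. Qed.

Lemma coef0M (p q : {poly C}) : (p * q)`_0 = p`_0 * q`_0.
Proof. by rewrite coefM big_ord1. Qed.

Lemma coef1M (p q : {poly C}) : (p * q)`_1 = p`_0 * q`_1 + p`_1 * q`_0.
Proof. by rewrite coefM big_ord_recl big_ord1. Qed.

Lemma weight0 j : (weight j)`_0 = 1.
Proof.
elim: j => [|j IH]; first by rewrite /weight big_ord0 coef1.
by rewrite weightS coef0M IH coefD coef1 coefZ coefX mulr0 addr0 mulr1.
Qed.

Lemma weight_slope j : (weight j.+1)`_1 - (weight j)`_1 = slope C K j.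
Proof.
rewrite weightS coef1M weight0 !coefD !coef1 !coefZ !coefX /=.
by rewrite !mulr0 !mulr1 !addr0 add0r mul1r mulr1 addrK.
Qed.

Lemma weight1_real j : (weight j)`_1 \is Num.real.
Proof.
elim: j => [|j IH]; first by rewrite /weight big_ord0 coef1 rpred0.
rewrite -(subrK (weight j)`_1 (weight j.+1)`_1) weight_slope rpredD// /slope.
by case: ifP => _; rewrite ?rpredV ?realn//; case: ifP => _; rewrite ?realn// rpred1.
Qed.

End Weights.

Section ExtendedEntries.
Context {C : numClosedFieldType} {s : nat}.

(** Extension by zero to all natural indices, so that the shifted relations need no boundary
    cases. *)
Definition entry (M : 'M[C]_s) (i j : nat) : C :=
  oapp (fun i' => oapp (fun j' => M i' j') 0 (insub j)) 0 (insub i).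

Lemma entryE M (i j : 'I_s) : entry M i j = M i j.
Proof. by rewrite /entry !valK. Qed.

Lemma entry_out M i j : (s <= i)%N || (s <= j)%N -> entry M i j = 0.
Proof.
rewrite /entry; case: (insubP 'I_s j) => [j' js _|_] /=; last by case: insub.
by rewrite orbC leqNgt js /= => si; rewrite insubF// ltnNge si.
Qed.

Lemma entry_adj M i j : entry (M ^t*) i j = (entry M j i)^*.
Proof.
rewrite /entry; case: insubP => [i' _ _|_] /=; case: insubP => [j' _ _|_] /=;
  by rewrite ?mxE ?conjC0.
Qed.

End ExtendedEntries.

(** * Limits of low-rank witnesses *)

Section UltraLimit.
Variables (U : set_system nat) (hU : UltraFilter U).

Section Poly.
Context {C : numFieldType}.

(** The symmetric difference quotient at 0 extracts the first-order coefficient and cancels the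
    constant term. *)
Lemma ulim_poly_sym (p : {poly C}) (t : nat -> C) : (forall q, t q != 0) -> ulim U t 0 ->
  ulim U (fun q => (p.[t q] - p.[- t q]) / (2 * t q)) p`_1.
Proof.
move=> t0 ht; elim/poly_ind: p => [|p c _].
  rewrite coef0; apply: eq_ulim (ulim_cst hU 0) => q.
  by rewrite !horner0 subr0 mul0r.
elim/poly_ind: p => [|p c1 _].
  rewrite mul0r add0r coefC; apply: eq_ulim (ulim_cst hU 0) => q.
  by rewrite !hornerC subrr mul0r.
rewrite coefD coefMX coefC /= addr0 coefD coefMX coefC /= add0r.
have hNt : ulim U (fun q => - t q) 0 by rewrite -oppr0; exact: ulimN.
have h := ulimM hU ht (ulimD hU (ulim_poly hU p ht) (ulimN hU (ulim_poly hU p hNt))).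
have := ulimD hU (ulim_cst hU c1) (ulimZ hU 2^-1 h).
rewrite mul0r mulr0 addr0; apply: eq_ulim => q.
by rewrite !hornerE /=; field; exact: t0.
Qed.

End Poly.

Section Core.
Context {C : numClosedFieldType}.
Hypothesis bounded_ulim : forall (f : nat -> C) (b : C), (forall q, `|f q| <= b) ->
  exists l, ulim U f l.

Lemma bounded_ulim_mx m n (M : nat -> 'M[C]_(m, n)) b :
  (forall q i j, `|M q i j| <= b) ->
  exists L : 'M[C]_(m, n), forall i j, ulim U (fun q => M q i j) (L i j).
Proof.
move=> hM.
have /choice[L hL] : forall ij : 'I_m * 'I_n, exists l, ulim U (fun q => M q ij.1 ij.2) l.
  by move=> ij; exact: bounded_ulim.
by exists (\matrix_(i, j) L (i, j)) => i j; rewrite mxE; exact: hL (i, j).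
Qed.

(** The operator on the second factor obtained from a witness with diagonal blocks A, D and upper
    block B by pairing the first factor with the vector (1, z). *)
Definition pencil s (A B D : 'M[C]_s) (z : C) : 'M[C]_s :=
  A + z *: B + z^* *: B ^t* + (z * z^*) *: D.

Definition zero_vector K (zeta t : C) : 'cV[C]_(nedges K).+1 :=
  \col_j (zeta ^+ j * (weight K j).[t]).

Section Limit.
Variables (K : nat) (zeta : nat -> C).
Local Notation s := (nedges K).+1.
Hypothesis zinj : injective zeta.
Hypothesis zunit : forall i, zeta i * (zeta i)^* = 1.

Definition shifted_weight k j : {poly C} := (1 + 'X) ^+ k * weight K j.

(** A row of the pencil at a zero vector, with evaluation in t replaced by a functional [Phi].
    Evaluation, difference quotients and coefficients thus share one formula, and limits pass
    through [Phi]. *)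
Definition row_sum (A B D : 'M[C]_s) (Phi : {poly C} -> C) i (l : 'I_s) : C :=
  \sum_(j < s) zeta i ^+ j * (A l j * Phi (shifted_weight 0 j)
    + zeta i * (B l j * Phi (shifted_weight 1 j))
    + (zeta i)^-1 * ((B j l)^* * Phi (shifted_weight 1 j))
    + D l j * Phi (shifted_weight 2 j)).

Lemma zeta_neq0 i : zeta i != 0.
Proof. by apply: contra_eq_neq (zunit i) => ->; rewrite mul0r eq_sym oner_neq0. Qed.

Lemma zeta_conj i : (zeta i)^* = (zeta i)^-1.
Proof. by rewrite -[RHS]mulr1 -(zunit i) mulKf// zeta_neq0. Qed.

Lemma pencil_zero_vector (A B D : 'M[C]_s) (t : C) i l : t \is Num.real ->
  (pencil A B D (zeta i * (1 + t)) *m zero_vector K (zeta i) t) l 0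
  = row_sum A B D (horner^~ t) i l.
Proof.
move=> tR; rewrite mxE; apply: eq_bigr => j _.
have t1 : (1 + t)^* = 1 + t by rewrite (CrealP _)// rpredD// rpred1.
have r1 : (1 + 'X : {poly C}).[t] = 1 + t by rewrite !hornerE.
rewrite !mxE rmorphM /= t1 zeta_conj /shifted_weight !hornerM !horner_exp r1.
by field; exact: zeta_neq0.
Qed.

Lemma row_sum_sym (A B D : 'M[C]_s) (t : C) i l :
  row_sum A B D (fun p => (p.[t] - p.[- t]) / (2 * t)) i l
  = (row_sum A B D (horner^~ t) i l - row_sum A B D (horner^~ (- t)) i l) / (2 * t).
Proof. by rewrite /row_sum -sumrB mulr_suml; apply: eq_bigr => j _; ring. Qed.

Lemma ulim_row_sum (A B D : nat -> 'M[C]_s) (A' B' D' : 'M[C]_s)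
    (Phi : nat -> {poly C} -> C) Phi' i l :
  (forall i j, ulim U (fun q => A q i j) (A' i j)) ->
  (forall i j, ulim U (fun q => B q i j) (B' i j)) ->
  (forall i j, ulim U (fun q => D q i j) (D' i j)) ->
  (forall p, ulim U (Phi^~ p) (Phi' p)) ->
  ulim U (fun q => row_sum (A q) (B q) (D q) (Phi q) i l) (row_sum A' B' D' Phi' i l).
Proof.
move=> hA hB hD hP; apply: ulim_sum => // j _; apply: ulimZ => //.
do 3 ?[apply: ulimD => //]; do ?[apply: ulimZ => //]; apply: ulimM => //.
exact: ulim_conj.
Qed.

Lemma pencil_herm (A B D : 'M[C]_s) z : A ^t* = A -> D ^t* = D ->
  (pencil A B D z) ^t* = pencil A B D z.
Proof.
move=> hA hD; rewrite /pencil !adjmxD !adjmxZ trmxCK conjCK hA hD rmorphM /= conjCK.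
by rewrite [z^* * z]mulrC -[A + z^* *: _ + _]addrA [z^* *: _ + _]addrC addrA.
Qed.

Variables (A B D : nat -> 'M[C]_s) (e : nat -> C) (b delta : C).
Hypothesis e_gt0 : forall q, 0 < e q.
Hypothesis e_le1 : forall q, e q <= 1.
Hypothesis e_lim : ulim U e 0.
Hypothesis A_herm : forall q, (A q) ^t* = A q.
Hypothesis D_herm : forall q, (D q) ^t* = D q.
Hypothesis A_bound : forall q i j, `|A q i j| <= b.
Hypothesis B_bound : forall q i j, `|B q i j| <= b.
Hypothesis D_bound : forall q i j, `|D q i j| <= b.
Hypothesis pencil_ge0 : forall q z y, 0 <= qform (pencil (A q) (B q) (D q) z) y.
Hypothesis B_rank : forall q, (\rank (B q) < K)%N.
Hypothesis zeros_small : forall q i (sg : bool), (i < s.+2)%N ->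
  let t := (-1) ^+ sg * e q ^+ 2 in
  qform (pencil (A q) (B q) (D q) (zeta i * (1 + t))) (zero_vector K (zeta i) t)
    <= e q ^+ 5 * b.

Let T q (sg : bool) : C := (-1) ^+ sg * e q ^+ 2.

Lemma bound_ge0 : 0 <= b.
Proof. exact: le_trans (normr_ge0 _) (A_bound 0 ord0 ord0). Qed.

Lemma T_real q sg : T q sg \is Num.real.
Proof. by rewrite rpredM ?rpredX ?rpredN ?rpred1// gtr0_real. Qed.

Lemma T_norm q sg : `|T q sg| = e q ^+ 2.
Proof. by rewrite /T normrM normrX normrN1 expr1n mul1r normrX gtr0_norm. Qed.

(* At [`|z| <= 2] the diagonal entries of the pencil are at most [(1 + 2 + 2 + 4) * b]. *)
Lemma row_small q i sg l : (i < s.+2)%N ->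
  `|row_sum (A q) (B q) (D q) (horner^~ (T q sg)) i l| ^+ 2
    <= (9 * b + 1) ^+ 2 * b * e q ^+ 5.
Proof.
move=> hi; rewrite -pencil_zero_vector ?T_real//.
set H := pencil _ _ _ _.
have hH : H ^t* = H by exact: pencil_herm.
apply: (le_trans (psd_mulmx_bound _ l hH (pencil_ge0 _ _))).
have Hll0 : 0 <= H l l.
  have := pencil_ge0 q (zeta i * (1 + T q sg)) (delta_mx l 0).
  rewrite /qform trmx_delta map_delta_mx -rowE -/H mxE (bigD1 l)//= big1 ?addr0.
    by rewrite !mxE !eqxx mulr1.
  by move=> j jl; rewrite !mxE (negbTE jl) mulr0.
have zn : `|zeta i| = 1.
  by apply/eqP; rewrite -[_ == 1](@eqrXn2 _ 2)// normCK zunit expr1n.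
have t1 : `|1 + T q sg| <= 2.
  rewrite (le_trans (ler_normD _ _))// normr1 T_norm -[2]/(1 + 1) lerD2l.
  by rewrite expr_le1// ltW.
have Hll : H l l <= 9 * b.
  rewrite -(ger0_norm Hll0) /H /pencil !mxE.
  have zz : `|zeta i * (1 + T q sg)| <= 2 by rewrite normrM zn mul1r.
  move: zz; move: (zeta i * _) => z zz.
  have zb M : `|M| <= b -> `|z * M| <= 2 * b by move=> h; rewrite normrM ler_pM.
  have zcb M : `|M| <= b -> `|z^* * M^*| <= 2 * b.
    by move=> h; rewrite normrM !norm_conjC ler_pM.
  have zzb M : `|M| <= b -> `|z * z^* * M| <= 4 * b.
    move=> h; rewrite !normrM norm_conjC ler_pM ?mulr_ge0//.
    by rewrite -[4]/((2 * 2)%:R) natrM ler_pM.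
  rewrite (le_trans (ler_normD _ _))//.
  have -> : 9 * b = (b + 2 * b + 2 * b) + 4 * b by ring.
  apply: lerD; last exact: zzb.
  rewrite (le_trans (ler_normD _ _))//; apply: lerD; last exact: zcb.
  by rewrite (le_trans (ler_normD _ _))//; apply: lerD => //; exact: zb.
rewrite -mulrA ler_pM ?exprn_ge0 ?addr_ge0 ?mulr_ge0 ?bound_ge0 ?pencil_ge0//.
  by rewrite lerXn2r ?nnegrE ?addr_ge0 ?mulr_ge0 ?bound_ge0// lerD2r.
by rewrite mulrC; exact: zeros_small.
Qed.

Lemma T_neq0 q sg : T q sg != 0.
Proof. by rewrite mulf_neq0 ?signr_eq0// expf_neq0// gt_eqF. Qed.

Lemma ulim_e2 : ulim U (fun q => e q ^+ 2) 0.
Proof. by have := ulimM hU e_lim e_lim; rewrite mulr0. Qed.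

Lemma ulim_T sg : ulim U (T^~ sg) 0.
Proof. by have := ulimZ hU ((-1) ^+ sg) ulim_e2; rewrite mulr0. Qed.

(** By [row_small] the squared row is O(e^5), while the squared denominator is 4 e^4; the quotient
    is O(e). *)
Lemma row_lim0 i sg l : (i < s.+2)%N ->
  ulim U (fun q => row_sum (A q) (B q) (D q) (horner^~ (T q sg)) i l / (2 * T q sg)) 0.
Proof.
move=> hi; apply: (ulim0_sqr hU).
have hM := ulimZ hU ((9 * b + 1) ^+ 2 * b) e_lim; rewrite mulr0 in hM.
apply: (ulim0_le hU _ hM) => q; rewrite ger0_norm ?exprn_ge0//.
have M0 : 0 <= (9 * b + 1) ^+ 2 * b.
  by rewrite mulr_ge0 ?bound_ge0// exprn_ge0// addr_ge0// mulr_ge0// bound_ge0.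
rewrite [leRHS]ger0_norm; last by rewrite mulr_ge0// ltW.
rewrite normrM normfV normrM T_norm normr_nat exprMn exprVn.
rewrite ler_pdivrMr ?exprn_gt0 ?mulr_gt0 ?exprn_gt0//.
apply: (le_trans (row_small q sg l hi)).
rewrite -[leRHS]mulrA ler_wpM2l// exprMn -exprM mulrCA [e q * _]mulrC -exprSr.
by rewrite ler_peMl ?exprn_ge0 ?(ltW (e_gt0 q))// -natrX ler1n.
Qed.

Lemma row_lim i sg l : (i < s.+2)%N ->
  ulim U (fun q => row_sum (A q) (B q) (D q) (horner^~ (T q sg)) i l) 0.
Proof.
move=> hi; have := ulimM hU (row_lim0 sg l hi) (ulimZ hU 2 (ulim_T sg)).
rewrite mul0r; apply: eq_ulim => q; rewrite divfK// mulf_neq0 ?T_neq0//.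
by rewrite pnatr_eq0.
Qed.

Lemma shifted_weight0 k j : (k <= 2)%N -> (shifted_weight k j)`_0 = 1.
Proof.
move=> k2; have h1 : (1 + 'X : {poly C})`_0 = 1 by rewrite coefD coef1 coefX addr0.
rewrite /shifted_weight coef0M weight0 mulr1.
by case: k k2 => [|[|[|//]]] _; rewrite ?expr0 ?expr1 ?expr2 ?coef0M ?coef1 ?h1 ?mulr1.
Qed.

Lemma shifted_weight1 k j : (k <= 2)%N ->
  (shifted_weight k j)`_1 = k%:R + (weight K j)`_1.
Proof.
move=> k2; have h1 : (1 + 'X : {poly C})`_0 = 1 by rewrite coefD coef1 coefX addr0.
have h2 : (1 + 'X : {poly C})`_1 = 1 by rewrite coefD coef1 coefX add0r.
rewrite /shifted_weight coef1M weight0 mulr1.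
case: k k2 => [|[|[|//]]] _; rewrite ?expr0 ?expr1 ?expr2 ?coef0M ?coef1M ?coef1 ?h1 ?h2.
- by rewrite mul1r addr0 add0r.
- by rewrite mul1r addrC.
- by rewrite !mulr1 !mul1r addrC.
Qed.

Lemma unit_kernel_lim (c : nat -> 'cV[C]_K) (f : 'I_K -> 'I_s) (B' : 'M[C]_s) :
  (forall i j, ulim U (fun q => B q i j) (B' i j)) ->
  (forall q, \sum_t c q t 0 * (c q t 0)^* = 1) ->
  (forall q i, \sum_t B q i (f t) * c q t 0 = 0) ->
  exists2 c' : 'cV[C]_K, exists t, c' t 0 != 0 & forall i, \sum_t B' i (f t) * c' t 0 = 0.
Proof.
move=> hB cc cB.
have [q i j|c' hc] := @bounded_ulim_mx _ _ c 1.
  rewrite (ord1 j) -(@ler_pXn2r _ 2) ?nnegrE// normCK expr1n -(cc q).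
  rewrite (bigD1 i)//= lerDl sumr_ge0// => t _; exact: mul_conjC_ge0.
exists c'.
  apply: contrapT => h; have c0 t : c' t 0 = 0.
    by apply/eqP/negPn/negP => ct; apply: h; exists t.
  have : ulim U (fun q => \sum_t c q t 0 * (c q t 0)^*) (\sum_t c' t 0 * (c' t 0)^*).
    by apply: ulim_sum => // t _; apply: ulimM => //; exact: ulim_conj.
  rewrite big1 => [|t _]; last by rewrite c0 mul0r.
  move=> h0; have := ulim_uniq hU h0 (eq_ulim (fun q => esym (cc q)) (ulim_cst hU 1)).
  by move/eqP; rewrite eq_sym oner_eq0.
move=> i.
have : ulim U (fun q => \sum_t B q i (f t) * c q t 0) (\sum_t B' i (f t) * c' t 0).
  by apply: ulim_sum => // t _; exact: ulimM.
move=> h0; exact: (ulim_uniq hU h0 (eq_ulim (fun q => esym (cB q i)) (ulim_cst hU 0))).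
Qed.

(** The limit blocks satisfy the coefficient relations and inherit kernel vectors on both halves, so
    [mid_coef_ge0] makes their middle entry nonnegative; a uniform gap below zero would survive in
    the limit. *)
Lemma no_small_witness : 0 < delta ->
  ~ (forall q, delta <= - 'Re (B q (inord K.+2) (inord K.+1))).
Proof.
move=> d0 low.
have [A' hA] := bounded_ulim_mx A_bound.
have [B' hB] := bounded_ulim_mx B_bound.
have [D' hD] := bounded_ulim_mx D_bound.
have herm (M : nat -> 'M[C]_s) (M' : 'M[C]_s) : (forall q, (M q) ^t* = M q) ->
    (forall i j, ulim U (fun q => M q i j) (M' i j)) -> M' ^t* = M'.
  move=> hM hl; apply/matrixP => i j; rewrite !mxE.
  apply: (ulim_uniq hU (ulim_conj hU (hl j i))).
  by apply: eq_ulim (hl i j) => q; rewrite (mxE_herm _ _ (hM q)).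
have hA' := herm _ _ A_herm hA; have hD' := herm _ _ D_herm hD.
have r0 i l : (i < s.+2)%N -> row_sum A' B' D' (fun p => p`_0) i l = 0.
  move=> hi; apply: (ulim_uniq hU _ (row_lim false l hi)).
  by apply: ulim_row_sum => // p; apply: ulim_poly => //; exact: ulim_T.
(* The two shifts are opposite, so adding the two quotients gives the symmetric difference quotient
   of the row. *)
have r1 i l : (i < s.+2)%N -> row_sum A' B' D' (fun p => p`_1) i l = 0.
  move=> hi; have := ulimD hU (row_lim0 false l hi) (row_lim0 true l hi).
  rewrite addr0; apply: (ulim_uniq hU).
  apply: (@eq_ulim _ _ (fun q => row_sum (A q) (B q) (D q)
      (fun p => (p.[T q false] - p.[- T q false]) / (2 * T q false)) i l)).
    move=> q; rewrite row_sum_sym.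
    have -> : T q true = - T q false by rewrite /T expr0 expr1 mul1r mulN1r.
    by rewrite mulrN invrN mulrN -mulrBl.
  apply: ulim_row_sum => // p; apply: ulim_poly_sym; last exact: ulim_T.
  by move=> q; exact: T_neq0.
pose sl j := (weight K j : {poly C})`_1.
pose a := entry A'; pose bb := entry B'; pose d := entry D'.
have out M i j : (s <= i)%N || (s <= j)%N -> entry M i j = 0 := @entry_out _ _ M i j.
have rel l : (bb 0%N l = 0 /\ forall j, a l j + d l j + (if j is j'.+1 then bb l j' else 0)
     + (bb j.+1 l)^* = 0) /\ (forall j, sl j * a l j + (2 + sl j) * d l j
     + (if j is j'.+1 then (1 + sl j') * bb l j' else 0) + (1 + sl j.+1) * (bb j.+1 l)^* = 0).
  have [ls|sl_l] := ltnP l s; last first.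
    split; first split.
    - by rewrite /bb out// sl_l orbT.
    - by case=> [|j]; rewrite /a /d /bb !out ?conjC0 ?sl_l ?orbT// !addr0.
    - by case=> [|j]; rewrite /a /d /bb !out ?conjC0 ?sl_l ?orbT// !mulr0 !addr0.
  pose l' := Ordinal ls.
  have [|i hi|bl h0] := @trig_vanish _ s zeta (fun j => a l j + d l j) (bb l)
      (fun j => (bb j l)^*) zinj zeta_neq0.
  - by move=> j js; rewrite /a /d /bb !out ?js ?orbT// addr0 conjC0.
  - rewrite -[RHS](r0 i l' hi); apply: eq_bigr => j _.
    rewrite !shifted_weight0// /a /d /bb -[l]/(val l') !entryE; ring.
  have [|i hi|_ h1] := @trig_vanish _ s zeta (fun j => sl j * a l j + (2 + sl j) * d l j)
      (fun j => (1 + sl j) * bb l j) (fun j => (1 + sl j) * (bb j l)^*) zinj zeta_neq0.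
  - by move=> j js; rewrite /a /d /bb !out ?js ?orbT// conjC0 !mulr0 addr0.
  - rewrite -[RHS](r1 i l' hi); apply: eq_bigr => j _.
    by rewrite !shifted_weight1// /a /d /bb -[l]/(val l') !entryE -/(sl j); ring.
  split=> //; split=> //.
  by rewrite -[bb 0 l]conjCK bl conjC0.
have fL_lt (t : 'I_K) : (t.+1 < s)%N by have := ltn_ord t; rewrite /nedges; lia.
have fR_lt (t : 'I_K) : (K.+2 + t < s)%N by have := ltn_ord t; rewrite /nedges; lia.
have kern f : exists2 c' : 'cV[C]_K, exists t, c' t 0 != 0
    & forall i, \sum_t B' i (f t) * c' t 0 = 0.
  have /choice[c hc] : forall q, exists c : 'cV[C]_K, \sum_t c t 0 * (c t 0)^* = 1 /\
      forall i, \sum_t B q i (f t) * c t 0 = 0.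
    by move=> q; have [c ? ?] := rank_kernel f (B_rank q); exists c.
  by apply: (unit_kernel_lim (c := c)) => // q; have [] := hc q.
pose vec (c : 'cV[C]_K) t := oapp (fun u : 'I_K => c u 0) 0 (insub t).
have vecE c (t : 'I_K) : vec c t = c t 0 by rewrite /vec valK.
have [cL [tL cL0] kL] := kern (fun t => Ordinal (fL_lt t)).
have [cR [tR cR0] kR] := kern (fun t => Ordinal (fR_lt t)).
have kvec (c : 'cV[C]_K) (f : 'I_K -> 'I_s) i : (forall i, \sum_t B' i (f t) * c t 0 = 0) ->
    \sum_(t < K) bb i (f t) * vec c t = 0.
  move=> h; have [is_|si] := ltnP i s.
    rewrite -[RHS](h (Ordinal is_)); apply: eq_bigr => t _.
    by rewrite vecE -entryE.
  by rewrite big1// => t _; rewrite /bb out ?si// mul0r.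
have posE z (y : nat -> C) : z \is Num.real ->
  0 <= \sum_(i < s) (y i)^* *
    (\sum_(j < s) (a i j + z * bb i j + z * (bb j i)^* + z ^+ 2 * d i j) * y j).
  move=> zR; apply: (ulim_ge0 hU (fun q => pencil_ge0 q z (\col_j y j))).
  have zz : z^* = z by rewrite (CrealP _).
  have pE (A0 B0 D0 : 'M[C]_s) : qform (pencil A0 B0 D0 z) (\col_j y j)
     = \sum_(i < s) \sum_(j < s) ((y i)^* * (A0 i j + z * B0 i j + z * (B0 j i)^*
         + z ^+ 2 * D0 i j) * y j).
    rewrite qformE; apply: eq_bigr => i _; apply: eq_bigr => j _.
    by rewrite !mxE zz expr2.
  have -> : \sum_(i < s) (y i)^* *
    (\sum_(j < s) (a i j + z * bb i j + z * (bb j i)^* + z ^+ 2 * d i j) * y j)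
    = qform (pencil A' B' D' z) (\col_j y j).
    rewrite pE; apply: eq_bigr => i _; rewrite mulr_sumr; apply: eq_bigr => j _.
    by rewrite /a /bb /d !entryE mulrA.
  rewrite pE; apply: (@eq_ulim _ _ (fun q => \sum_(i < s) \sum_(j < s) ((y i)^* *
      (A q i j + z * B q i j + z * (B q j i)^* + z ^+ 2 * D q i j) * y j))).
    by move=> q; rewrite pE.
  apply: ulim_sum => // i _; apply: ulim_sum => // j _.
  apply: (ulimM hU _ (ulim_cst hU _)); apply: (ulimM hU (ulim_cst hU _)).
  by do 3 ?[apply: ulimD => //]; do ?[apply: ulimZ => //]; exact: ulim_conj.
have mid : 0 <= bb K.+2 K.+1.
  apply: (@mid_coef_ge0 _ K a bb d sl _ _ _ _ _ _ _ _ _ _ (vec cL) (vec cR)).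
  - by move=> i j h; rewrite /a out// h orbT.
  - by move=> i j h; rewrite /bb out.
  - by move=> i j h; rewrite /d out// h orbT.
  - by move=> i j; rewrite /a -{2}hA' entry_adj.
  - by move=> i j; rewrite /d -{2}hD' entry_adj.
  - by move=> j; exact: weight1_real.
  - by move=> l; have [[]] := rel l.
  - by move=> l; have [[]] := rel l.
  - by move=> l; have [] := rel l.
  - by move=> j _; exact: weight_slope.
  - by exists tL => //; rewrite vecE.
  - by exists tR => //; rewrite vecE.
  - by move=> i; apply: (kvec _ (fun t => Ordinal (fL_lt t))).
  - by move=> i; apply: (kvec _ (fun t => Ordinal (fR_lt t))).
  - exact: posE.
pose i1 : 'I_s := inord K.+2; pose j1 : 'I_s := inord K.+1.
have Bmid : bb K.+2 K.+1 = B' i1 j1.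
  by rewrite -entryE /i1 /j1 !inordK// /nedges; lia.
have RE (x : C) : 'Re x = 2^-1 * (x + x^*) by rewrite ReE mulrC.
have lim : ulim U (fun q => - 'Re (B q i1 j1) - delta) (- 'Re (B' i1 j1) - delta).
  apply: ulimD => //; last exact: ulim_cst.
  apply: ulimN; have h := ulimZ hU 2^-1 (ulimD hU (hB i1 j1) (ulim_conj hU (hB i1 j1))).
  rewrite (RE (B' i1 j1)); apply: (@eq_ulim _ _ _ _ _ _ h) => q; exact/esym/RE.
have := ulim_ge0 hU _ lim; rewrite subr_ge0.
have -> : 'Re (B' i1 j1) = B' i1 j1 by apply/Creal_ReP; rewrite ger0_real// -Bmid.
move=> h; have : delta <= - B' i1 j1 by apply: h => q; rewrite subr_ge0.
rewrite lerNr => h2; have : 0 <= - delta by apply: le_trans h2; rewrite -Bmid.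
by rewrite oppr_ge0 lt_geF.
Qed.

End Limit.
End Core.
End UltraLimit.

(** * Nonnegativity of the chain form *)

Section Positivity.
Context {C : numClosedFieldType}.
Local Notation sq x := (x * x^*).

(** S times the gap between the two sides is a weighted sum of squared moduli, where S is the first
    factor on the right. *)
Lemma weighted_cauchy (I : finType) (w x c : I -> C) :
  (forall i, 0 < w i) -> 0 < \sum_i sq (x i) / w i ->
  sq (\sum_i x i * c i) <= (\sum_i sq (x i) / w i) * \sum_i w i * sq (c i).
Proof.
move=> w0; set S := \sum_i _ / _ => S0; set t := \sum_i _ * c _; set W := \sum_i w _ * _.
rewrite -subr_ge0 -(pmulr_rge0 _ S0).
have SR : S^* = S by rewrite (CrealP _)// ger0_real// ltW.
have wR i : (w i)^* = w i by rewrite (CrealP _)// ger0_real// ltW.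
have -> : S * (S * W - sq t) = \sum_i w i * sq (S * c i - t * ((x i)^* / w i)).
  have tE : t^* = \sum_i (x i)^* * (c i)^*.
    by rewrite /t rmorph_sum; apply: eq_bigr => i _; rewrite rmorphM.
  transitivity (S ^+ 2 * W - S * (t^* * t) - S * (t * t^*) + S * (t * t^*)).
    by ring.
  rewrite [in X in _ - X - _]/t {1}tE /W.
  rewrite [in X in _ + X]/S -[X in _ = X]subr0.
  transitivity (\sum_i (S ^+ 2 * (w i * sq (c i)) - S * (t^* * (x i * c i))
      - S * (t * ((x i)^* * (c i)^*)) + (t * t^*) * (sq (x i) / w i))).
    rewrite big_split !sumrB /= -!mulr_sumr.
    rewrite -tE; ring.
  rewrite subr0; apply: eq_bigr => i _.
  rewrite rmorphB !rmorphM /= SR fmorphV /= wR conjCK.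
  by field; rewrite gt_eqF.
by apply: sumr_ge0 => i _; rewrite mulr_ge0 ?mul_conjC_ge0// ltW.
Qed.

(* Weighted Cauchy-Schwarz on half of the chain: [u] and [v] are the coefficients of
   the differences [d] and [c0] of the end edge. *)
Lemma half_chain_bound K (z u v d c0 : C) (c : nat -> C) :
  let q := 1 - sq z in let D := 3 * sq u + sq v + q * (1 - sq z ^+ K) in
  0 < D ->
  3 * sq (u * d + v * c0 + q * \sum_(t < K) z ^+ (K - t.+1) * c t)
   <= D * (sq d + 3 * sq c0 + 3 * \sum_(t < K) sq (c t)).
Proof.
move=> q D D0.
pose w (i : 'I_K.+2) : C := if i is Ordinal 0 _ then 1 else 3.
pose x (i : 'I_K.+2) : C := match val i with 0 => u | 1 => v
  | t.+2 => q * z ^+ (K - t.+1) end.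
pose y (i : 'I_K.+2) : C := match val i with 0 => d | 1 => c0 | t.+2 => c t end.
have w0 i : 0 < w i by rewrite /w; case: i => -[|i] _; rewrite ?ltr01 ?ltr0n.
have sum3 (F : 'I_K.+2 -> C) : \sum_i F i = F ord0 + F (lift ord0 ord0)
    + \sum_(t < K) F (lift ord0 (lift ord0 t)).
  by rewrite big_ord_recl big_ord_recl addrA.
have qR : q^* = q by rewrite rmorphB rmorph1 rmorphM /= conjCK [z^* * z]mulrC.
have SE : \sum_i sq (x i) / w i = D / 3.
  rewrite sum3 /x /w /= invr1 mulr1.
  (* The factor q telescopes the geometric sum, which keeps D polynomial in the squared modulus of
     z. *)
  have geo : q * \sum_(t < K) sq z ^+ (K - t.+1) = 1 - sq z ^+ K.
    rewrite (reindex_inj rev_ord_inj) /=.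
    rewrite (eq_bigr (fun t : 'I_K => sq z ^+ t)); last first.
      by move=> t _; congr (_ ^+ _); have := ltn_ord t; lia.
    by rewrite -[RHS]opprB subrX1 -mulNr opprB.
  have -> : \sum_(t < K) sq (q * z ^+ (K - t.+1)) / 3 = q * (1 - sq z ^+ K) / 3.
    rewrite -geo mulrA mulr_sumr mulr_suml; apply: eq_bigr => t _.
    by rewrite exprMn rmorphM rmorphXn /= qR; ring.
  by rewrite /D; field.
have := @weighted_cauchy _ w x y w0; rewrite SE.
have D3 : 0 < D / 3 by rewrite divr_gt0// ltr0n.
move=> /(_ D3); rewrite !sum3 /x /y /w /= mul1r -mulr_sumr => h.
have -> : q * \sum_(t < K) z ^+ (K - t.+1) * c t = \sum_(t < K) q * z ^+ (K - t.+1) * c t.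
  by rewrite mulr_sumr; apply: eq_bigr => t _; rewrite mulrA.
rewrite (le_trans (ler_wpM2l _ h))//.
set W := (X in D / 3 * X); have -> : 3 * (D / 3 * W) = D * W by field.
exact: lexx.
Qed.

Lemma mid_edge_form (z q u v : C) : q^* = q ->
  sq q * (3 * sq (z * u - v) - sq (u - z^* * v)) = (3 * sq z - 1) * sq (q * u)
   + (3 - sq z) * sq (q * v) - 2 * (z * (q * u) * (q * v)^* + z^* * (q * u)^* * (q * v)).
Proof. by move=> qR; rewrite !rmorphB !rmorphM /= conjCK qR; ring. Qed.

Lemma sq_diff (x y a b z : C) : x^* = x -> y^* = y ->
  sq (x * b - y * (z * a)) = x ^+ 2 * sq b + y ^+ 2 * sq z * sq a
    - x * y * (z * a * b^* + z^* * a^* * b).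
Proof. by move=> xR yR; rewrite !rmorphB !rmorphM /= xR yR; ring. Qed.

(* Completes the square in the middle 2x2 form, whose discriminant is a multiple of
   [(T - 1) ^+ 2]. *)
Lemma chain_discriminant (R rho Sa Sb X : C) :
  let q := 1 - R in let T := R * rho in let D1 := 4 - rho * q in let D2 := 4 * T + q in
  let N := 4 * (3 - R) - 2 * T * q in
  N * D2 * (D1 * ((4 * T * (3 * R - 1) + 2 * q) * Sa) + D2 * (N * Sb) - 2 * D1 * D2 * X)
  = (N * D2) ^+ 2 * Sb + (2 * D1 * D2) ^+ 2 * R * Sa - N * D2 * (2 * D1 * D2) * X
    + D1 * D2 * 24 * q ^+ 2 * (T - 1) ^+ 2 * Sa.
Proof. by move=> q T D1 D2 N; rewrite /N /D2 /D1 /T /q; ring. Qed.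

(** The sign of q decides which rewriting into nonnegative terms applies, hence the split at R =
    1. *)
Lemma chain_coef_gt0 K (R : C) : 0 <= R -> let q := 1 - R in
  [/\ 0 < 4 - R ^+ K * q, 0 < 4 * R ^+ K.+1 + q & 0 < 4 * (3 - R) - 2 * R ^+ K.+1 * q].
Proof.
move=> R0 q; pose rho := R ^+ K; pose T := R ^+ K.+1.
have TE : T = R * rho by rewrite /T exprS.
have realR : R \is Num.real by rewrite ger0_real.
have rho0 : 0 <= rho by rewrite exprn_ge0.
have T0 : 0 <= T by rewrite exprn_ge0.
rewrite -/rho -/T; have /orP[R1|R1] := real_leVge realR (real1 _).
  have q0 : 0 <= q by rewrite subr_ge0.
  have T1 : T <= 1 by rewrite exprn_ile1.
  have rho1 : rho <= 1 by rewrite exprn_ile1.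
  split.
  - rewrite subr_gt0 (@le_lt_trans _ _ 1) ?ltr1n// -[leRHS]mulr1 ler_pM//.
    by rewrite gerBl.
  - have [R1'|RN1] := eqVneq R 1.
      by rewrite /T /q R1' expr1n mulr1 subrr addr0 ltr0n.
    by rewrite ltr_wpDl ?mulr_ge0// subr_gt0 lt_neqAle RN1.
  - have -> : 4 * (3 - R) - 2 * T * q = 6 + (4 * q + 2 * (T * R) + 2 * (1 - T)).
      by rewrite /q; ring.
    by rewrite ltr_wpDr ?ltr0n// 2?addr_ge0 ?mulr_ge0 ?subr_ge0.
have TR : R <= T by rewrite TE -[leLHS]mulr1 ler_wpM2l// exprn_ege1.
have q0 : q <= 0 by rewrite subr_le0.
split.
- by rewrite ltr_wpDr ?ltr0n// oppr_ge0 mulr_ge0_le0.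
- have -> : 4 * T + q = 4 * (T - R) + (3 * R + 1) by rewrite /q; ring.
  by rewrite ltr_wpDl ?mulr_ge0 ?subr_ge0// ltr_wpDl// mulr_ge0.
- have -> : 4 * (3 - R) - 2 * T * q
      = 2 * ((T - R) * (R - 1)) + (2 * (R - 3 / 2) ^+ 2 + 15 / 2) by rewrite /q; field.
  have r2 : 0 <= (R - 3 / 2) ^+ 2.
    by rewrite real_exprn_even_ge0// rpredB// rpred_div ?realn.
  have h : 0 <= (T - R) * (R - 1) by rewrite mulr_ge0 ?subr_ge0.
  apply: ltr_wpDl; first by rewrite mulr_ge0.
  by apply: ltr_wpDl; [rewrite mulr_ge0|rewrite divr_gt0 ?ltr0n].
Qed.

Section Form.
Variables (K : nat) (z : C) (y : nat -> C).
Local Notation n := (nedges K).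
Local Notation c j := (z * y j - y j.+1).
Local Notation d j := (y j - z^* * y j.+1).

(** Each half of the chain bounds from below its share of the form by the value at the adjacent site
    of the middle edge; a two-variable form in those two values remains, and [chain_discriminant]
    settles it. *)
Lemma chain_form_ge0 :
  0 <= 3 * (\sum_(j < n) sq (c j)) + sq (d 0%N) + sq (d (K + K.+1).+1) - sq (d K.+1).
Proof.
rewrite (sum_edges K (fun j => sq (c j))) /=.
set R := sq z; set q := 1 - R.
have R0 : 0 <= R by exact: mul_conjC_ge0.
(* On the unit circle the two differences of the middle edge have equal modulus, so the coefficient
   3 absorbs the negative term. *)
have [q0|q0] := eqVneq q 0.
  have zz : z * z^* = 1 by apply/esym/eqP; rewrite -subr_eq0 -/R -/q q0.
  have dc : sq (d K.+1) = sq (c K.+1).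
    have -> : d K.+1 = z^* * c K.+1 by rewrite mulrBr mulrA [z^* * z]mulrC zz mul1r.
    by rewrite rmorphM /= conjCK mulrACA [z^* * z]mulrC zz mul1r.
  rewrite dc; set s1 := \sum_(t < K) sq (c t.+1); set s2 := \sum_(t < K) sq (c _).
  have -> : 3 * (sq (c 0%N) + s1 + sq (c K.+1) + s2 + sq (c (K + K.+1).+1))
     + sq (d 0%N) + sq (d (K + K.+1).+1) - sq (c K.+1)
     = 3 * (sq (c 0%N) + s1 + s2 + sq (c (K + K.+1).+1))
     + sq (d 0%N) + sq (d (K + K.+1).+1) + 2 * sq (c K.+1) by ring.
  have h1 : 0 <= s1 by apply: sumr_ge0 => t _; exact: mul_conjC_ge0.
  have h2 : 0 <= s2 by apply: sumr_ge0 => t _; exact: mul_conjC_ge0.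
  have p x : 0 <= sq x by exact: mul_conjC_ge0.
  by rewrite 3?addr_ge0 ?p//; apply: mulr_ge0; rewrite // 3?addr_ge0 ?p.
pose a := q * y K.+1; pose b := q * y K.+2.
pose rho := R ^+ K; pose T := R ^+ K.+1.
pose D1 := 4 - rho * q; pose D2 := 4 * T + q; pose Nb := 4 * (3 - R) - 2 * T * q.
have TE : T = R * rho by rewrite /T exprS.
have qR : q^* = q by rewrite rmorphB rmorph1 rmorphM /= conjCK [z^* * z]mulrC.
have realR : R \is Num.real by rewrite ger0_real.
have rho0 : 0 <= rho by rewrite exprn_ge0.
have T0 : 0 <= T by rewrite exprn_ge0.
have q2 : 0 < sq q.
  by rewrite lt_def mul_conjC_ge0 mul_conjC_eq0 q0.
have [D10 D20 Nb0] := chain_coef_gt0 K R0; rewrite -/q -/rho -/T -/D1 -/D2 -/Nb in D10 D20 Nb0.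
set s1 := \sum_(t < K) sq (c t.+1); set s2 := \sum_(t < K) sq (c _).
set Lf := sq (d 0%N) + 3 * sq (c 0%N) + 3 * s1.
set Rt := sq (d (K + K.+1).+1) + 3 * sq (c (K + K.+1).+1) + 3 * s2.
have iter i t : y (i + t)%N = z ^+ t * y i
    - \sum_(u < t) z ^+ (t - u.+1) * c (i + u)%N.
  elim: t => [|t IH]; first by rewrite addn0 expr0 mul1r big_ord0 subr0.
  rewrite addnS big_ord_recr /= subnn expr0 mul1r.
  have -> : \sum_(u < t) z ^+ (t.+1 - u.+1) * c (i + u)%N
      = z * \sum_(u < t) z ^+ (t - u.+1) * c (i + u)%N.
    rewrite mulr_sumr; apply: eq_bigr => u _.
    by rewrite mulrA -exprS subSS subnSK.
  by rewrite exprS; move: IH; set S := \sum_(u < t) _ => ->; ring.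
(* The identity [z * d 0 - c 0 = q * y 1], propagated along the left half, expresses a through the
   edge differences. *)
have hL : 3 * sq a <= D2 * Lf.
  have := @half_chain_bound K z (z ^+ K.+1) (- z ^+ K) (d 0%N) (c 0%N) (fun t => - c t.+1).
  cbv zeta; rewrite -/R -/q.
  have -> : 3 * sq (z ^+ K.+1) + sq (- z ^+ K) + q * (1 - R ^+ K) = D2.
    by rewrite rmorphN rmorphXn rmorphXn /= mulrNN -!exprMn -/R -/T /D2 TE /rho /q; ring.
  move=> /(_ D20).
  have -> : \sum_(t < K) sq (- c t.+1) = s1.
    by apply: eq_bigr => t _; rewrite rmorphN mulrNN.
  have -> : z ^+ K.+1 * d 0%N + - z ^+ K * c 0%N
      + q * (\sum_(t < K) z ^+ (K - t.+1) * - c t.+1) = a.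
    rewrite /a -add1n iter.
    rewrite (eq_bigr (fun t : 'I_K => - (z ^+ (K - t.+1) * c (1 + t)%N))).
      rewrite sumrN exprS; set S := \sum_(t < K) _; rewrite /q /R; ring.
    by move=> t _; rewrite mulrN add1n.
  by [].
have hR : 3 * (rho * sq b) <= D1 * Rt.
  have := @half_chain_bound K z 1 (- z^*) (d (K + K.+1).+1) (c (K + K.+1).+1)
    (fun t => c (K.+2 + t)%N).
  cbv zeta; rewrite -/R -/q.
  have -> : 3 * sq 1 + sq (- z^*) + q * (1 - R ^+ K) = D1.
    by rewrite rmorphN /= conjC1 conjCK mulrNN [z^* * z]mulrC -/R /D1 /rho /q; ring.
  move=> /(_ D10).
  have -> : 1 * d (K + K.+1).+1 + - z^* * c (K + K.+1).+1
      + q * (\sum_(t < K) z ^+ (K - t.+1) * c (K.+2 + t)%N) = z ^+ K * b.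
    have e1 : (K + K.+1).+1 = (K.+2 + K)%N by lia.
    have e2 := iter K.+2 K; rewrite -e1 in e2.
    set S := \sum_(u < K) _ in e2 *.
    have -> : z ^+ K * b = q * (y (K + K.+1).+1 + S) by rewrite e2 subrK /b mulrCA.
    by rewrite /q /R; ring.
  by rewrite rmorphM rmorphXn /= mulrACA -exprMn.
have mid : sq q * (3 * sq (c K.+1) - sq (d K.+1))
   = (3 * R - 1) * sq a + (3 - R) * sq b - 2 * (z * a * b^* + z^* * a^* * b).
  exact: mid_edge_form.
rewrite -(pmulr_rge0 _ q2).
have -> : sq q * (3 * (sq (c 0%N) + s1 + sq (c K.+1) + s2 + sq (c (K + K.+1).+1))
     + sq (d 0%N) + sq (d (K + K.+1).+1) - sq (d K.+1))
  = sq q * (3 * sq (c K.+1) - sq (d K.+1)) + sq q * (Lf + Rt).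
  rewrite /Lf /Rt; ring.
rewrite mid -(pmulr_rge0 _ (mulr_gt0 (mulr_gt0 D10 D20) (mulr_gt0 Nb0 D20))).
set x := z * a * b^*; set x' := z^* * a^* * b.
pose G := D1 * ((4 * T * (3 * R - 1) + 2 * q) * sq a) + D2 * (Nb * sq b)
  - 2 * D1 * D2 * (x + x').
have GE : Nb * D2 * G = sq (Nb * D2 * b - 2 * D1 * D2 * (z * a))
   + D1 * D2 * 24 * q ^+ 2 * (T - 1) ^+ 2 * sq a.
  have cR (r : C) : 0 < r -> r^* = r by move=> h; rewrite (CrealP _)// gtr0_real.
  have e1 : (Nb * D2)^* = Nb * D2 by apply: cR; rewrite mulr_gt0.
  have e2 : (2 * D1 * D2)^* = 2 * D1 * D2 by apply: cR; rewrite !mulr_gt0 ?ltr0n.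
  rewrite (sq_diff _ _ _ e1 e2) -/x -/x' -/R.
  have := chain_discriminant R rho (sq a) (sq b) (x + x'); cbv zeta.
  by rewrite -TE -/q -/D1 -/D2 -/Nb => <-.
have qq : q ^+ 2 = sq q by rewrite qR expr2.
have T1 : 0 <= (T - 1) ^+ 2 by rewrite real_exprn_even_ge0// rpredB ?real1 ?ger0_real.
have D12 : 0 <= D1 * D2 by rewrite ltW// mulr_gt0.
have ND : 0 <= Nb * D2 by rewrite ltW// mulr_gt0.
have G0 : 0 <= Nb * D2 * G.
  rewrite GE addr_ge0 ?mul_conjC_ge0// mulr_ge0 ?mul_conjC_ge0// mulr_ge0//.
  by rewrite qq mulr_ge0 ?mul_conjC_ge0// mulr_ge0.
(* After clearing positive denominators, the form splits into the discriminant part G and the slacks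
   of the two half-chain bounds. *)
have -> : D1 * D2 * (Nb * D2) * ((3 * R - 1) * sq a + (3 - R) * sq b - 2 * (x + x')
    + sq q * (Lf + Rt)) = Nb * D2 * G + Nb * D2 * q ^+ 2 *
      (D2 * Lf - 3 * sq a) * D1 + Nb * D2 * q ^+ 2 * (D2 * (D1 * Rt - 3 * (rho * sq b))).
  rewrite -qq /G; move: (sq a) (sq b) (x + x') Lf Rt hL hR => Sa Sb X L1 R1 _ _.
  by rewrite /Nb /D1 /D2 TE /q; ring.
have NDq : 0 <= Nb * D2 * q ^+ 2 by rewrite mulr_ge0// qq mul_conjC_ge0.
apply: addr_ge0; first apply: addr_ge0 => //.
  by apply: mulr_ge0; [rewrite mulr_ge0// subr_ge0|exact: ltW].
by rewrite mulr_ge0// mulr_ge0 ?subr_ge0// ltW.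
Qed.

End Form.

End Positivity.

(** * Complex limits and a free ultrafilter *)

Section ComplexLimit.
Context {R : realType}.
Variables (U : set_system nat) (hU : UltraFilter U).
Local Notation C := (R[i]).
Local Notation "r %:C" := (real_complex R r) (at level 1, format "r %:C").

Lemma norm_real_complex (r : R) : `|r%:C| = `|r|%:C.
Proof. by rewrite normc_def /= expr0n addr0 sqrtr_sqr. Qed.

Lemma ulim_real_complex (f : nat -> R) l : ulim U f l ->
  ulim U (fun q => (f q)%:C) l%:C.
Proof.
move=> h e e0; have [r r0 eE] := ge0_real_complex (ltW e0).
have rp : 0 < r by rewrite -ltcR -eE.
apply: filterS (h _ rp) => q; rewrite -rmorphB norm_real_complex eE ltcR.
by [].
Qed.

Lemma bounded_ulim_complex (f : nat -> C) (b : C) : (forall q, `|f q| <= b) ->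
  exists l, ulim U f l.
Proof.
move=> fb; have [r r0 offdiag_kap] := ge0_real_complex (le_trans (normr_ge0 _) (fb 0%N)).
have reb q : `|complex.Re (f q)| <= r.
  by rewrite -lecR -offdiag_kap (le_trans _ (fb q))// normc_ge_Re.
have imb q : `|complex.Im (f q)| <= r.
  rewrite -lecR -offdiag_kap (le_trans _ (fb q))//.
  have -> : `|f q| = `|f q * 'i%C|.
    by rewrite normrM normc_def normc_def /= expr0n expr1n add0r sqrtr1 mulr1.
  by rewrite -normrN -ReiNIm normc_ge_Re.
have [a ha] := bounded_ulim_real hU reb; have [c hc] := bounded_ulim_real hU imb.
exists (a%:C + 'i%C * c%:C).
apply: eq_ulim (ulimD hU (ulim_real_complex ha) (ulimZ hU 'i%C (ulim_real_complex hc))).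
by move=> q; rewrite [RHS]complexE.
Qed.

Lemma ulim_harmonic : (forall N, U (fun q => (N <= q)%N)) ->
  ulim U (fun q => q.+1%:R^-1 : C) 0.
Proof.
move=> hN.
have h : ulim U (fun q => q.+1%:R^-1 : R) 0.
  move=> e e0; apply: filterS (hN (Num.bound e^-1)) => q hq.
  rewrite subr0 ger0_norm ?invr_ge0// invf_plt ?posrE//.
  apply: (lt_le_trans (archi_boundP _)); first by rewrite invr_ge0 ltW.
  by rewrite ler_nat ltnW.
have := ulim_real_complex h; rewrite rmorph0; apply: eq_ulim => q.
by rewrite fmorphV rmorph_nat.
Qed.

End ComplexLimit.

Lemma ultrafilter_nat : exists U : set_system nat,
  UltraFilter U /\ forall N, U (fun q => (N <= q)%N).
Proof.
have [U [hU sub]] := ultraFilterLemma eventually_filter.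
by exists U; split=> // N; apply: sub; exists N.
Qed.

Lemma mxtrace_mul_delta (C : numClosedFieldType) n (W : 'M[C]_n) i j : \tr (W *m delta_mx i j) = W j i.
Proof.
rewrite /mxtrace (bigD1 j)//= big1 ?addr0 => [|l lj]; rewrite mxE (bigD1 i)//= big1 ?addr0.
- by rewrite !mxE !eqxx mulr1.
- by move=> l li; rewrite !mxE (negbTE li) mulr0.
- by rewrite !mxE (negbTE lj) andbF mulr0.
- by move=> u ui; rewrite !mxE (negbTE ui) mulr0.
Qed.

(** * Uniform bounds on dual witnesses *)

Section BoundedWitness.
Context {R : realType}.
Local Notation C := (R[i]).

Lemma witness_sepsum k s (W : 'M[C]_(k * s)) M : dual_witness W -> sepsum M ->
  0 <= \tr (W *m M).
Proof.
move=> [_ hW _] [m [p [b [h ->]]]]; rewrite mulmx_sumr raddf_sum sumr_ge0// => i _.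
by have [? ?] := h i; exact: hW.
Qed.

(** Absorb the Hermitian part of M with either sign; the normalization [\tr W = 1] makes the bound
    independent of W. *)
Lemma witness_absorbed k s (M : 'M[C]_(k * s)) : exists2 t : C, 0 <= t
  & forall W, dual_witness W -> `|\tr (W *m (M + M ^t*))| <= t.
Proof.
have [t1 t10 h1] := absorbed_adj M; have [t2 t20 h2] := absorbed_adj (- M).
exists (t1 + t2); first exact: addr_ge0.
move=> W hW; set x := \tr _; have [_ _ trW] := hW.
have x1 : 0 <= x + t1.
  by have := witness_sepsum hW h1; rewrite mulmxDr -scalemxAr mulmx1 linearD linearZ /= trW mulr1.
have x2 : 0 <= - x + t2.
  have := witness_sepsum hW h2.
  rewrite adjmxN -opprD mulmxDr -scalemxAr mulmx1 mulmxN linearD linearN linearZ /= trW.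
  by rewrite mulr1.
have xR : x \is Num.real.
  by rewrite -(addrK t1 x) rpredB ?ger0_real.
rewrite real_ler_norml//; apply/andP; split.
  by rewrite -subr_ge0 opprK addrA addr_ge0.
by rewrite -subr_ge0 addrAC -addrA addr_ge0// addrC.
Qed.

(** Each entry is a combination of two traces against Hermitian parts, those of a matrix unit and of
    ['i] times it. The bound gives the compactness needed for the ultralimit. *)
Lemma witness_bounded k s : exists2 b : C, 0 <= b
  & forall W : 'M[C]_(k * s), dual_witness W -> forall i j, `|W i j| <= b.
Proof.
have /choice[t ht] : forall M : 'M[C]_(k * s), exists t : C, 0 <= t /\
    forall W, dual_witness W -> `|\tr (W *m (M + M ^t*))| <= t.
  by move=> M; have [t ? ?] := witness_absorbed M; exists t.
pose B i j := t (delta_mx i j) + t ('i *: delta_mx i j).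
have B0 i j : 0 <= B i j by apply: addr_ge0; exact: (ht _).1.
exists (\sum_i \sum_j B i j); first by rewrite sumr_ge0// => i _; rewrite sumr_ge0.
move=> W hW i j.
have i2 : 'i * 'i = -1 :> C by rewrite -expr2 sqrCi.
have WE : W i j = 2^-1 * (\tr (W *m (delta_mx i j + (delta_mx i j) ^t*))
   + 'i * \tr (W *m ('i *: delta_mx i j + ('i *: delta_mx i j) ^t*))).
  rewrite adjmxZ trmx_delta map_delta_mx !mulmxDr -!scalemxAr !linearD !linearZ /=.
  rewrite !mxtrace_mul_delta conjCi.
  have -> : W j i + W i j + 'i * ('i * W j i + - 'i * W i j)
      = W j i + W i j + ('i * 'i) * (W j i - W i j) by ring.
  rewrite i2 (_ : _ + _ = W i j *+ 2); last by ring.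
  by rewrite -[W i j *+ 2]mulr_natl mulKf// pnatr_eq0.
apply: (@le_trans _ _ (B i j)).
  rewrite WE normrM ger0_norm ?invr_ge0//.
  set S := _ + _; have h : `|S| <= B i j.
    rewrite (le_trans (ler_normD _ _))// lerD ?(ht _).2// normrM normCi mul1r.
    exact: (ht _).2.
  rewrite (le_trans _ h)// ler_piMl// invf_le1 ?ltr0n// ler1n//.
rewrite (bigD1 i)//= (bigD1 j)//= -addrA lerDl addr_ge0 ?sumr_ge0// => a _.
by apply: sumr_ge0.
Qed.

End BoundedWitness.

(** * The functional on the chain *)

Section Witness.
Context {C : numClosedFieldType}.
Variables (k K : nat) (i0 i1 : 'I_k).
Hypothesis i01 : i0 != i1.
Local Notation n := (nedges K).
Local Notation s := n.+1.
Local Notation sq x := (x * x^*).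

Definition site (a : 'I_k) (j : nat) : 'I_(k * s) :=
  mxtens.mxtens_index (a, inord j : 'I_s).

(** On a product projection this is a squared modulus. Exchanging u and v swaps the diagonal entries
    only, which amounts to conjugating the vector of the first factor. *)
Definition edge_term (u v : 'I_k) (j : nat) (M : 'M[C]_(k * s)) : C :=
  M (site u j) (site u j) + M (site v j.+1) (site v j.+1)
  - M (site i1 j) (site i0 j.+1) - M (site i0 j.+1) (site i1 j).

Definition chain_witness (M : 'M[C]_(k * s)) : C :=
  3 * (\sum_(j < n) edge_term i1 i0 j M) + edge_term i0 i1 0 M
  + edge_term i0 i1 (K + K.+1).+1 M - edge_term i0 i1 K.+1 M.

Lemma chain_witnessD M N : chain_witness (M + N) = chain_witness M + chain_witness N.
Proof.
rewrite /chain_witness (eq_bigr (fun j : 'I_n => edge_term i1 i0 j M + edge_term i1 i0 j N)).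
  by rewrite big_split /= /edge_term !mxE; ring.
by move=> j _; rewrite /edge_term !mxE; ring.
Qed.

Lemma chain_witnessZ a M : chain_witness (a *: M) = a * chain_witness M.
Proof.
rewrite /chain_witness (eq_bigr (fun j : 'I_n => a * edge_term i1 i0 j M)).
  by rewrite -mulr_sumr /edge_term !mxE; ring.
by move=> j _; rewrite /edge_term !mxE; ring.
Qed.

Lemma chain_witness_sum I (r : seq I) (P : pred I) (F : I -> 'M[C]_(k * s)) :
  chain_witness (\sum_(i <- r | P i) F i) = \sum_(i <- r | P i) chain_witness (F i).
Proof.
apply: (big_morph _ chain_witnessD).
by rewrite -(scale0r (0 : 'M_(k * s))) chain_witnessZ mul0r.
Qed.

Definition product_proj (x : 'cV[C]_k) (y : 'cV[C]_s) : 'M[C]_(k * s) :=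
  (x *m x ^t*) *t (y *m y ^t*).

Lemma product_projE x y a b i j :
  product_proj x y (site a i) (site b j)
  = x a 0 * (x b 0)^* * (y (inord i) 0 * (y (inord j) 0)^*).
Proof.
by rewrite /product_proj /site mxtens.tensmxE !mxE !big_ord1 !mxE.
Qed.

Lemma chain_witness_proj (x : 'cV[C]_k) (y : 'cV[C]_s)
    (v := fun j => y (inord j) 0) (p := x i0 0) (r := x i1 0) :
  chain_witness (product_proj x y) =
  3 * (\sum_(j < n) sq (r * v j - p * v j.+1)) + sq (p^* * v 0%N - r^* * v 1%N)
  + sq (p^* * v (K + K.+1).+1 - r^* * v n) - sq (p^* * v K.+1 - r^* * v K.+2).
Proof.
have E1 j : edge_term i1 i0 j (product_proj x y) = sq (r * v j - p * v j.+1).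
  by rewrite /edge_term !product_projE -/p -/r rmorphB !rmorphM /= /v; ring.
have E2 j : edge_term i0 i1 j (product_proj x y) = sq (p^* * v j - r^* * v j.+1).
  by rewrite /edge_term !product_projE -/p -/r rmorphB !rmorphM /= !conjCK /v; ring.
by rewrite /chain_witness !E2; under eq_bigr do rewrite E1.
Qed.

(** For p nonzero, scale to [chain_form_ge0] at z = r / p. For p = 0 the single negative square is
    one of those counted three times in the sum. *)
Lemma homogeneous_form_ge0 (p r : C) (v : nat -> C) :
  0 <= 3 * (\sum_(j < n) sq (r * v j - p * v j.+1)) + sq (p^* * v 0%N - r^* * v 1%N)
  + sq (p^* * v (K + K.+1).+1 - r^* * v n) - sq (p^* * v K.+1 - r^* * v K.+2).
Proof.
have [p0|pN] := eqVneq p 0.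
  rewrite p0 conjC0.
  rewrite (eq_bigr (fun j : 'I_n => sq r * sq (v j))); last first.
    by move=> j _; rewrite mul0r subr0 rmorphM /=; ring.
  rewrite !mul0r !sub0r !rmorphN !mulrNN !rmorphM /= !conjCK -mulr_sumr.
  have K2 : (K.+2 < n)%N by rewrite /nedges; lia.
  have S : sq (v K.+2) <= 3 * \sum_(j < n) sq (v j).
    rewrite (bigD1 (Ordinal K2))//= mulrDr -[leLHS]addr0 lerD//.
      by rewrite ler_peMl ?mul_conjC_ge0 ?ler1n.
    by rewrite mulr_ge0// sumr_ge0// => j _; exact: mul_conjC_ge0.
  set S1 := \sum_(j < n) _ in S *.
  have -> : 3 * (sq r * S1) + r^* * v 1%N * (r * (v 1%N)^*)
      + r^* * v n * (r * (v n)^*) - r^* * v K.+2 * (r * (v K.+2)^*)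
    = sq r * ((3 * S1 - sq (v K.+2)) + sq (v 1%N) + sq (v n)) by ring.
  by rewrite mulr_ge0 ?mul_conjC_ge0// addr_ge0 ?mul_conjC_ge0// addr_ge0 ?mul_conjC_ge0//
    subr_ge0.
have := mulr_ge0 (mul_conjC_ge0 p) (chain_form_ge0 K (r / p) v).
suff -> : sq p * (3 * (\sum_(j < n) sq (r / p * v j - v j.+1)) +
    sq (v 0%N - (r / p)^* * v 1%N) + sq (v (K + K.+1).+1 - (r / p)^* * v (K + K.+1).+2)
    - sq (v K.+1 - (r / p)^* * v K.+2))
  = 3 * (\sum_(j < n) sq (r * v j - p * v j.+1)) + sq (p^* * v 0%N - r^* * v 1%N)
  + sq (p^* * v (K + K.+1).+1 - r^* * v n) - sq (p^* * v K.+1 - r^* * v K.+2) by [].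
have pcN : p^* != 0 by rewrite conjC_eq0.
have sqM (a c : C) : sq (a * c) = sq a * sq c by rewrite rmorphM mulrACA.
have e1 a c : sq (r * a - p * c) = sq p * sq (r / p * a - c).
  have -> : r * a - p * c = p * (r / p * a - c) by field.
  exact: sqM.
have e2 a c : sq (p^* * a - r^* * c) = sq p * sq (a - (r / p)^* * c).
  have -> : p^* * a - r^* * c = p^* * (a - (r / p)^* * c) by rewrite fmorph_div /=; field.
  by rewrite sqM conjCK [p^* * p]mulrC.
under [in RHS]eq_bigr do rewrite e1.
by rewrite !e2 -mulr_sumr; ring.
Qed.

Lemma chain_witness_proj_ge0 x y : 0 <= chain_witness (product_proj x y).
Proof. by rewrite chain_witness_proj; exact: (@homogeneous_form_ge0 _ _ (fun j => y (inord j) 0)). Qed.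

Lemma chain_witness_sepsum M : sepsum M -> 0 <= chain_witness M.
Proof.
move=> [m [p [b [h ->]]]]; rewrite chain_witness_sum sumr_ge0// => nu _.
have [/psd_rank1_sum[v ->] /psd_rank1_sum[w ->]] := h nu.
have -> : (\sum_i v i *m (v i)^t*) *t (\sum_i w i *m (w i)^t*)
    = \sum_i \sum_j product_proj (v i) (w j).
  apply/matrixP => a c; case: (mxtens.mxtens_indexP a) => a1 a2.
  case: (mxtens.mxtens_indexP c) => c1 c2; rewrite mxtens.tensmxE !summxE mulr_suml.
  apply: eq_bigr => i _; rewrite summxE mulr_sumr; apply: eq_bigr => j _.
  by rewrite mxtens.tensmxE.
rewrite chain_witness_sum sumr_ge0// => i _; rewrite chain_witness_sum sumr_ge0// => j _.
exact: chain_witness_proj_ge0.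
Qed.

Lemma site_eq a b i j : (i < s)%N -> (j < s)%N ->
  (site a i == site b j) = (a == b) && (i == j).
Proof.
move=> is_ js; rewrite (can_eq (@mxtens.mxtens_indexK _ _)) xpair_eqE.
by rewrite -[inord i == _]val_eqE /= !inordK.
Qed.

Lemma chain_witness1 : chain_witness 1%:M = (6 * n + 2)%:R.
Proof.
have E u v j : u != v -> (j < n)%N -> edge_term u v j 1%:M = 2.
  move=> uv jn; rewrite /edge_term !mxE !eqxx.
  by rewrite !site_eq ?ltnS// 1?ltnW// [i1 == i0]eq_sym (negbTE i01) /= !subr0.
rewrite /chain_witness !E//; try by rewrite /nedges; lia.
  under eq_bigr => j _ do rewrite E ?ltn_ord 1?eq_sym//.
  by rewrite sumr_const card_ord addrK natrD -[2 *+ n]mulr_natr mulrA -!natrM.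
Qed.

(** Supported on the off-diagonal pair of the middle edge. Its edge term there is 1, which enters
    [chain_witness] with weight 3 - 1. *)
Definition mid_exchange : 'M[C]_(k * s) :=
  - (2^-1 *: (delta_mx (site i1 K.+1) (site i0 K.+2) + delta_mx (site i0 K.+2) (site i1 K.+1))).

Lemma chain_witness_mid : chain_witness mid_exchange = 2.
Proof.
have n1 : (K.+1 < s)%N by rewrite /nedges; lia.
have n2 : (K.+2 < s)%N by rewrite /nedges; lia.
have i10 : i1 != i0 by rewrite eq_sym.
have diag a l : (l < s)%N -> mid_exchange (site a l) (site a l) = 0.
  move=> ls; rewrite /mid_exchange !mxE !site_eq//.
  have [->|] := eqVneq a i1; first by rewrite (negbTE i10) /= andbF addr0 mulr0 oppr0.
  by rewrite /= andbF addr0 mulr0 oppr0.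
have off1 j : (j < n)%N ->
    mid_exchange (site i1 j) (site i0 j.+1) = - (2^-1 * (j == K.+1)%:R).
  move=> jn; rewrite /mid_exchange !mxE !site_eq ?ltnS// 1?ltnW//.
  by rewrite !eqxx (negbTE i10) /= eqSS andbb addr0.
have off2 j : (j < n)%N ->
    mid_exchange (site i0 j.+1) (site i1 j) = - (2^-1 * (j == K.+1)%:R).
  move=> jn; rewrite /mid_exchange !mxE !site_eq ?ltnS// 1?ltnW//.
  by rewrite !eqxx (negbTE i01) /= eqSS andbb add0r.
have E u v j : (j < n)%N -> edge_term u v j mid_exchange = (j == K.+1)%:R.
  move=> jn; rewrite /edge_term !diag ?off1 ?off2 ?ltnS// 1?ltnW//.
  by field.
rewrite /chain_witness !E; try by rewrite /nedges; lia.
rewrite eqxx (_ : ((K + K.+1).+1 == K.+1) = false); last by lia.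
have K1n : (K.+1 < n)%N by rewrite /nedges; lia.
have -> : \sum_(j < n) edge_term i1 i0 j mid_exchange = 1.
  rewrite (bigD1 (Ordinal K1n))//= E// eqxx big1 ?addr0// => j; rewrite -val_eqE /= => jK.
  by rewrite E ?ltn_ord// (negbTE jK).
by rewrite /= !mulr0n !mulr1n !addr0; ring.
Qed.

End Witness.

(** * The operator *)

Section Blocks.
Context {C : numClosedFieldType}.

Lemma sum_tens k s (F : 'I_(k * s) -> C) :
  \sum_u F u = \sum_a \sum_i F (mxtens.mxtens_index (a, i)).
Proof.
rewrite pair_big; symmetry; rewrite [RHS](reindex (@mxtens.mxtens_index k s)) /=.
  by apply: eq_bigr => -[a i] _.
exists (@mxtens.mxtens_unindex k s) => u _; first exact: mxtens.mxtens_indexK.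
exact: mxtens.mxtens_unindexK.
Qed.

Definition tens_block k s (W : 'M[C]_(k * s)) (a b : 'I_k) : 'M[C]_s :=
  \matrix_(i, j) W (mxtens.mxtens_index (a, i)) (mxtens.mxtens_index (b, j)).

Lemma tens_block_adj k s (W : 'M[C]_(k * s)) a b :
  W ^t* = W -> (tens_block W a b) ^t* = tens_block W b a.
Proof. by move=> hW; apply/matrixP => i j; rewrite !mxE mxE_herm. Qed.

(** Shows that blocks of a witness lifted through V factor through dimension d, hence have rank at
    most d. *)
Lemma tens_block_conj k s d (V : 'M[C]_(s, d)) (W : 'M[C]_(k * d))
    (I := (1%:M : 'M[C]_k) *t V) a b :
  tens_block (I *m W *m I ^t*) a b = V *m tens_block W a b *m V ^t*.
Proof.
have IE c i (F : 'I_(k * d) -> C) :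
    \sum_u I (mxtens.mxtens_index (c, i)) u * F u
    = \sum_j V i j * F (mxtens.mxtens_index (c, j)).
  rewrite sum_tens (bigD1 c)//= [X in _ + X]big1 ?addr0 => [|c' cc'].
    by apply: eq_bigr => j _; rewrite mxtens.tensmxE mxE eqxx mul1r.
  by rewrite big1// => j _; rewrite mxtens.tensmxE mxE eq_sym (negbTE cc') !mul0r.
apply/matrixP => i j; rewrite 3!mxE.
transitivity (\sum_u (I (mxtens.mxtens_index (b, j)) u)^* *
    \sum_l V i l * W (mxtens.mxtens_index (a, l)) u).
  by apply: eq_bigr => u _; rewrite mxE IE mulrC !mxE.
rewrite -[LHS]conjCK rmorph_sum /=.
under eq_bigr do rewrite rmorphM /= conjCK.
rewrite IE rmorph_sum /=; apply: eq_bigr => l _.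
by rewrite rmorphM /= conjCK mulrC !mxE; congr (_ * _); apply: eq_bigr => l' _; rewrite mxE.
Qed.

End Blocks.

Section Operator.
Context {C : numClosedFieldType}.
Variables (k K : nat) (i0 i1 : 'I_k).
Hypothesis i01 : i0 != i1.
Local Notation n := (nedges K).
Local Notation s := n.+1.
Local Notation sq x := (x * x^*).

Lemma trace_product_proj (W : 'M[C]_(k * s)) x y : \tr (W *m product_proj x y) =
  \sum_a \sum_b (x a 0)^* * x b 0 * qform (tens_block W a b) y.
Proof.
rewrite /mxtrace sum_tens; apply: eq_bigr => a _.
transitivity (\sum_i \sum_b \sum_j (x a 0)^* * x b 0 *
    ((y i 0)^* * tens_block W a b i j * y j 0)).
  apply: eq_bigr => i _; rewrite mxE sum_tens; apply: eq_bigr => b _.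
  apply: eq_bigr => j _.
  by rewrite /product_proj mxtens.tensmxE !mxE !big_ord1 !mxE; ring.
rewrite exchange_big /=; apply: eq_bigr => b _.
rewrite qformE mulr_sumr; apply: eq_bigr => i _.
by rewrite mulr_sumr.
Qed.

Definition qubit (z : C) : 'cV[C]_k :=
  \col_a (if a == i0 then 1 else if a == i1 then z else 0).

Lemma qubit_sum (z : C) (F : 'I_k -> C) : (forall a, a != i0 -> a != i1 -> F a = 0) ->
  \sum_a F a = F i0 + F i1.
Proof.
move=> F0; rewrite (bigD1 i0)//= (bigD1 i1) 1?eq_sym//= big1 ?addr0//.
by move=> a /andP[? ?]; exact: F0.
Qed.

Lemma trace_qubit_proj (W : 'M[C]_(k * s)) z y : W ^t* = W -> \tr (W *m product_proj (qubit z) y) =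
  qform (pencil (tens_block W i0 i0) (tens_block W i0 i1) (tens_block W i1 i1) z) y.
Proof.
move=> hW; rewrite trace_product_proj.
have i10 : (i1 == i0) = false by rewrite eq_sym (negbTE i01).
have q0 : qubit z i0 0 = 1 by rewrite mxE eqxx.
have q1 : qubit z i1 0 = z by rewrite mxE i10 eqxx.
have qN a : a != i0 -> a != i1 -> qubit z a 0 = 0.
  by move=> a0 a1; rewrite mxE (negbTE a0) (negbTE a1).
rewrite (qubit_sum z); last first.
  by move=> a a0 a1; rewrite big1// => b _; rewrite qN// conjC0 !mul0r.
rewrite !(qubit_sum z); last first.
- by move=> a a0 a1; rewrite (qN a a0 a1) mulr0 mul0r.
- by move=> a a0 a1; rewrite (qN a a0 a1) mulr0 mul0r.
rewrite q0 q1 conjC1 /pencil !qformD !qformZ tens_block_adj//; ring.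
Qed.

Section Family.
Variables (zeta : nat -> C) (delta : C).
Hypothesis zunit : forall i, zeta i * (zeta i)^* = 1.

Definition shift (e : C) (sg : bool) : C := (-1) ^+ sg * e ^+ 2.

Definition near_zero_proj (e : C) (p : bool * 'I_s.+2) : 'M[C]_(k * s) :=
  product_proj (qubit (zeta p.2 * (1 + shift e p.1))) (zero_vector K (zeta p.2) (shift e p.1)).

(* [chain_witness] of each projection is O(e^6), so it stays negligible after the
   factor e^-5.  A witness with nonpositive trace against the operator has values
   O(e^5) at the zero vectors, hence rows O(e^(5/2)) = o(e^2), which controls the
   first derivative in the shift e^2. *)
Definition chain_operator (e : C) : 'M[C]_(k * s) :=
  e ^- 5 *: (\sum_p near_zero_proj e p) + delta *: 1%:M - mid_exchange K i0 i1.

Lemma product_proj_psd x (y : 'cV[C]_s) : psdmx (@product_proj C k K x y).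
Proof. by apply: tens_psd; exact: rank1_psd. Qed.

Lemma chain_operator_herm e : 0 < e -> delta \is Num.real ->
  (chain_operator e) ^t* = chain_operator e.
Proof.
move=> e0 dR; rewrite /chain_operator !adjmxD adjmxN !adjmxZ.
have -> : (\sum_p near_zero_proj e p) ^t* = \sum_p near_zero_proj e p.
  apply/hermsymmxP; have [] // : psdmx (\sum_p near_zero_proj e p).
  by apply: psd_sum => p _; exact: product_proj_psd.
have -> : (mid_exchange K i0 i1 : 'M[C]_(k * s)) ^t* = mid_exchange K i0 i1.
  rewrite /mid_exchange adjmxN adjmxZ adjmxD !trmx_delta !map_delta_mx addrC.
  by rewrite fmorphV /= conjC_nat.
rewrite adjmx_scalar conjC1 fmorphV rmorphXn /= [delta^*](CrealP dR).
by rewrite [e^*](CrealP _)// gtr0_real.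
Qed.

Lemma trace_chain_operator (W : 'M[C]_(k * s)) e : W ^t* = W -> \tr W = 1 ->
  \tr (W *m chain_operator e) =
  e ^- 5 * (\sum_(p : bool * 'I_s.+2) qform (pencil (tens_block W i0 i0)
     (tens_block W i0 i1) (tens_block W i1 i1) (zeta p.2 * (1 + shift e p.1)))
     (zero_vector K (zeta p.2) (shift e p.1)))
  + delta + 'Re (tens_block W i0 i1 (inord K.+2) (inord K.+1)).
Proof.
move=> hW trW; rewrite /chain_operator mulmxBr mulmxDr -!scalemxAr mulmx1 mulmx_sumr.
rewrite linearB linearD !linearZ /= trW mulr1 raddf_sum.
congr (_ * _ + _ + _).
  apply: eq_bigr => p _; rewrite -[LHS]/(\tr (W *m near_zero_proj e p)) /near_zero_proj.
  exact: trace_qubit_proj.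
rewrite /mid_exchange mulmxN -scalemxAr mulmxDr linearN linearZ linearD /= opprK.
by rewrite !mxtrace_mul_delta ReE mulrC !mxE (mxE_herm _ _ hW).
Qed.

Lemma poly_bounded (p : {poly C}) : exists2 b : C, 0 <= b
  & forall t, `|t| <= 1 -> `|p.[t]| <= b.
Proof.
exists (\sum_(i < size p) `|p`_i|); first by apply: sumr_ge0.
move=> t t1; rewrite horner_coef (le_trans (ler_norm_sum _ _ _))// ler_sum// => i _.
by rewrite normrM normrX ler_piMr// exprn_ile1.
Qed.

Lemma weight_real j t : t \is Num.real -> (weight K j : {poly C}).[t] \is Num.real.
Proof.
move=> tR; elim: j => [|j IH]; first by rewrite /weight big_ord0 hornerC rpred1.
rewrite weightS hornerM rpredM// !hornerE rpredD ?rpred1// rpredM// /slope.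
by case: ifP => _; rewrite ?rpredV ?realn//; case: ifP => _; rewrite ?realn ?rpred1.
Qed.

(** Edges of slope 1 contribute nothing to the sum of weight 3. The remaining terms are t^2 times a
    polynomial g vanishing at 0, so the value is O(t^3), and the modulus of t is e^2. *)
Lemma chain_witness_near_zero : exists2 b : C, 0 <= b & forall (e : C) p, 0 < e -> e <= 1 ->
  chain_witness i0 i1 (near_zero_proj e p) <= e ^+ 6 * b.
Proof.
(* [gE] is 3/4 + (3/2 + t/2)^2 for an end edge and [gM] is (3 + 2t)^2 - 3 for the middle one; at t =
   0 they give 3 - 6 + 3 = 0. *)
pose gE : {poly C} := 3%:P + (3 / 2) *: 'X + 4^-1 *: 'X^2.
pose gM : {poly C} := 6%:P + 12 *: 'X + 4 *: 'X^2.
pose w := @weight C K.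
pose g := w 0%N ^+ 2 * gE - w K.+1 ^+ 2 * gM + w (K + K.+1).+1 ^+ 2 * gE.
have g0 : root g 0.
  rewrite rootE /g /gE /gM !(hornerD, hornerN, hornerM, hornerZ, hornerC, hornerX, hornerXn, horner_exp) !horner_coef0 !weight0.
  by apply/eqP; ring.
have /factor_theorem[h gh] := g0.
have [b b0 hb] := poly_bounded h; exists b => // e [sg i] e0 e1.
rewrite -[leLHS]ger0_norm; last exact: chain_witness_proj_ge0.
rewrite /near_zero_proj chain_witness_proj /=; set ze := zeta i.
have tn : `|shift e sg| = e ^+ 2.
  by rewrite /shift normrM normrX normrN1 expr1n mul1r normrX gtr0_norm.
have tR : shift e sg \is Num.real.
  by rewrite rpredM ?rpredX ?rpredN ?rpred1// gtr0_real.
move: (shift e sg) tn tR => t tn tR.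
have zz : ze * ze^* = 1 by exact: zunit.
have i10 : (i1 == i0) = false by rewrite eq_sym (negbTE i01).
have vE j : (j < s)%N -> zero_vector K ze t (inord j) 0 = ze ^+ j * (w j).[t].
  by move=> js; rewrite mxE inordK.
have wS j : (w j.+1).[t] = (w j).[t] * (1 + slope C K j * t).
  by rewrite /w weightS hornerM !hornerE.
have wR j : ((w j).[t])^* = (w j).[t] by apply/CrealP/weight_real.
have slR j : (slope C K j)^* = slope C K j.
  apply/CrealP; rewrite /slope.
  by case: ifP => _; rewrite ?rpredV ?realn//; case: ifP => _; rewrite ?realn ?rpred1.
have tC : t^* = t by apply/CrealP.
have unitX j : ze ^+ j * (ze^*) ^+ j = 1 by rewrite -exprMn zz expr1n.
have q0 z : qubit z i0 0 = 1 by rewrite mxE eqxx.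
have q1 z : qubit z i1 0 = z by rewrite mxE i10 eqxx.
rewrite q0 q1 conjC1.
have cE j : (j < n)%N -> sq (ze * (1 + t) * zero_vector K ze t (inord j) 0
     - 1 * zero_vector K ze t (inord j.+1) 0)
    = (w j).[t] ^+ 2 * t ^+ 2 * (1 - slope C K j) ^+ 2.
  move=> jn; rewrite !vE ?ltnS// 1?ltnW// wS.
  have -> : ze * (1 + t) * (ze ^+ j * (w j).[t])
      - 1 * (ze ^+ j.+1 * ((w j).[t] * (1 + slope C K j * t)))
     = ze ^+ j.+1 * ((w j).[t] * t * (1 - slope C K j)) by rewrite exprS; ring.
  rewrite !rmorphM rmorphXn rmorphB rmorph1 /= slR wR tC.
  by rewrite mulrACA unitX mul1r; ring.
have dE j : (j < n)%N -> sq (1 * zero_vector K ze t (inord j) 0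
     - (ze * (1 + t))^* * zero_vector K ze t (inord j.+1) 0)
    = (w j).[t] ^+ 2 * (1 - (1 + t) * (1 + slope C K j * t)) ^+ 2.
  move=> jn; rewrite !vE ?ltnS// 1?ltnW// wS.
  have -> : 1 * (ze ^+ j * (w j).[t])
      - (ze * (1 + t))^* * (ze ^+ j.+1 * ((w j).[t] * (1 + slope C K j * t)))
     = ze ^+ j * ((w j).[t] * (1 - (1 + t) * (1 + slope C K j * t))).
    rewrite rmorphM rmorphD rmorph1 /= tC exprS.
    transitivity (ze ^+ j * (w j).[t] - (ze * ze^*) * (ze ^+ j * ((w j).[t] *
      ((1 + t) * (1 + slope C K j * t))))); first by ring.
    by rewrite zz; ring.
  rewrite rmorphM rmorphXn /= mulrACA unitX mul1r.
  rewrite rmorphM rmorphB rmorph1 rmorphM !rmorphD !rmorph1 rmorphM /= slR wR tC.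
  by ring.
have K1n : (K.+1 < n)%N by rewrite /nedges; lia.
have s0 : slope C K 0 = 2^-1 by [].
have sm : slope C K K.+1 = 2.
  by rewrite /slope eqxx ifF//; apply/negbTE; rewrite negb_or /=; lia.
have sl : slope C K (K + K.+1).+1 = 2^-1 by rewrite /slope eqxx orbT.
have s1 u : (u < K)%N -> slope C K u.+1 = 1 /\ slope C K (K.+2 + u)%N = 1.
  by move=> uK; rewrite /slope !ifF//; lia.
have -> : \sum_(j < n) sq (ze * (1 + t) * zero_vector K ze t (inord j) 0
     - 1 * zero_vector K ze t (inord j.+1) 0) =
   t ^+ 2 * (4^-1 * (w 0%N).[t] ^+ 2 + (w K.+1).[t] ^+ 2 + 4^-1 * (w (K + K.+1).+1).[t] ^+ 2).
  rewrite (eq_bigr (fun j : 'I_n => (w j).[t] ^+ 2 * t ^+ 2 * (1 - slope C K j) ^+ 2)).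
    rewrite (sum_edges K (fun j => (w j).[t] ^+ 2 * t ^+ 2 * (1 - slope C K j) ^+ 2)).
    rewrite big1 => [|u _]; last by rewrite (s1 u _).1// subrr expr0n mulr0.
    rewrite big1 => [|u _]; last by rewrite (s1 u _).2// subrr expr0n mulr0.
    by rewrite s0 sm sl; field.
  by move=> j _; rewrite cE.
rewrite !dE ?s0 ?sm ?sl//.
rewrite (_ : _ - _ = t ^+ 2 * g.[t]); last first.
  by rewrite /g /gE /gM !(hornerD, hornerN, hornerM, hornerZ, hornerC, hornerX, hornerXn, horner_exp); field.
have gt : g.[t] = t * h.[t] by rewrite gh !hornerE subr0 mulrC.
rewrite gt mulrA -exprSr.
rewrite normrM normrX tn -exprM ler_wpM2l ?exprn_ge0 ?(ltW e0)// hb//.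
by rewrite tn exprn_ile1// ltW.
Qed.

End Family.
End Operator.

(** * Unit points and negativity of the functional *)

Section UnitPoints.
Context {C : numClosedFieldType}.

(** The Cayley transform provides infinitely many distinct unit points by purely algebraic means. *)
Definition cayley (u : nat) : C := (u%:R + 'i) / (u%:R - 'i).

Lemma natDi_neq0 (u : nat) : u%:R + 'i != 0 :> C.
Proof.
apply/negP => /eqP h; have : (u%:R + 'i) * (u%:R - 'i) = 0 :> C by rewrite h mul0r.
have -> : (u%:R + 'i) * (u%:R - 'i) = (u * u + 1)%:R :> C.
  rewrite natrD natrM; transitivity (u%:R * u%:R - 'i ^+ 2 : C); first by ring.
  by rewrite sqrCi opprK.
by move/eqP; rewrite pnatr_eq0 addn1.
Qed.

Lemma natBi_neq0 (u : nat) : u%:R - 'i != 0 :> C.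
Proof. by rewrite -conjC_eq0 rmorphB /= conjC_nat conjCi opprK natDi_neq0. Qed.

Lemma cayley_unit u : cayley u * (cayley u)^* = 1.
Proof.
rewrite /cayley fmorph_div rmorphD rmorphB /= conjC_nat conjCi opprK.
by field; rewrite natDi_neq0 natBi_neq0.
Qed.

Lemma cayley_inj : injective cayley.
Proof.
move=> u v /eqP; rewrite /cayley eqr_div ?natBi_neq0// -subr_eq0.
have -> : (u%:R + 'i) * (v%:R - 'i) - (v%:R + 'i) * (u%:R - 'i)
  = 2 * 'i * (v%:R - u%:R) :> C by ring.
rewrite !mulf_eq0 pnatr_eq0 (negbTE (neq0Ci C)) /= subr_eq0 eqr_nat.
by move=> /eqP.
Qed.

End UnitPoints.

Section Negative.
Context {C : numClosedFieldType}.
Variables (k K : nat) (i0 i1 : 'I_k) (zeta : nat -> C).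
Hypothesis i01 : i0 != i1.
Hypothesis zunit : forall i, zeta i * (zeta i)^* = 1.

(* The inverse of [chain_witness 1%:M]. *)
Definition gap : C := (6 * nedges K + 2)%:R^-1.

Lemma gap_gt0 : 0 < gap.
Proof. by rewrite invr_gt0 ltr0n addn2. Qed.

(** The identity term contributes 1, the exchange term -2, and the projections at most e * N * b,
    which is below 1 for the chosen e0. *)
Lemma chain_witness_operator_lt0 : exists2 e0 : C, 0 < e0 <= 1 & forall e : C, 0 < e -> e <= e0 ->
  chain_witness i0 i1 (chain_operator K i0 i1 zeta gap e) < 0.
Proof.
have [b b0 hb] := chain_witness_near_zero K i01 zunit.
pose N : C := #|{: bool * 'I_(nedges K).+3}|%:R.
have Nb0 : 0 <= N * b by rewrite mulr_ge0 ?ler0n.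
have Nb1 : 0 < N * b + 1 by rewrite ltr_wpDl.
exists (N * b + 1)^-1; first by rewrite invr_gt0 Nb1 invf_le1// lerDr.
move=> e e_gt0 ee0.
have e1 : e <= 1 by rewrite (le_trans ee0)// invf_le1// lerDr.
rewrite /chain_operator -[- mid_exchange _ _ _]scaleN1r !chain_witnessD !chain_witnessZ.
rewrite chain_witness_sum chain_witness1// chain_witness_mid//.
rewrite mulVf ?pnatr_eq0 ?addn2// mulN1r.
have h : e ^- 5 * (\sum_p chain_witness (K := K) i0 i1 (near_zero_proj i0 i1 zeta e p)) <= e * (N * b).
  rewrite ler_pdivrMl ?exprn_gt0// [e ^+ 5 * _]mulrA -(exprSr e 5).
  have -> : e ^+ 6 * (N * b) = \sum_(p : bool * 'I_(nedges K).+3) e ^+ 6 * b.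
    by rewrite sumr_const -[RHS]mulr_natr -/N; ring.
  by apply: ler_sum => p _; exact: hb.
have h2 : e * (N * b) < 1.
  rewrite (le_lt_trans (ler_wpM2r Nb0 ee0))// ltr_pdivrMl// mulr1 ltrDl//.
have -> x : x + 1 - 2 = x - 1 :> C by ring.
by rewrite subr_lt0 (le_lt_trans h).
Qed.

End Negative.

(** * Absence of low-rank witnesses *)

Section NoWitness.
Context {R : realType}.
Local Notation C := (R[i]).
Variables (k K : nat) (i0 i1 : 'I_k).
Hypothesis i01 : i0 != i1.
Local Notation s := (nedges K).+1.
Local Notation X := (chain_operator K i0 i1 (@cayley C) (@gap C K)).

Definition low_rank_witness (e : C) (W : 'M[C]_(k * s)) : Prop :=
  [/\ dual_witness W, (\rank (tens_block W i0 i1) < K)%N & \tr (W *m X e) <= 0].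

(** Otherwise every scale e0 / (q + 1) has a low-rank witness, and the sequence of these is excluded
    by [no_small_witness]. *)
Lemma exists_no_witness (e0 : C) : 0 < e0 <= 1 ->
  exists e, 0 < e <= e0 /\ forall W, ~ low_rank_witness e W.
Proof.
move=> /andP[e0_gt0 e0_le1]; apply: contrapT => hno.
pose e (q : nat) : C := e0 * q.+1%:R^-1.
have e_gt0 q : 0 < e q by rewrite mulr_gt0 ?invr_gt0 ?ltr0n.
have e_le q : e q <= e0 by rewrite ler_piMr ?(ltW e0_gt0)// invf_le1 ?ltr0n// ler1n.
have e_le1 q : e q <= 1 := le_trans (e_le q) e0_le1.
have /choice[W hW] : forall q, exists W, low_rank_witness (e q) W.
  move=> q; apply: contrapT => h; apply: hno; exists (e q); split; first by rewrite e_gt0 e_le.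
  by move=> W hW; apply: h; exists W.
have [U [hU hN]] := ultrafilter_nat.
have e_lim : ulim U e 0 by have := ulimZ hU e0 (ulim_harmonic (R := R) hU hN); rewrite mulr0.
have [b b0 hb] := witness_bounded (R := R) k s.
have Wd q : dual_witness (W q) by case: (hW q).
have Wh q : (W q) ^t* = W q by case: (Wd q).
pose blk a c q := tens_block (W q) a c.
have bb a c q i j : `|blk a c q i j| <= b by rewrite mxE; exact: hb.
have pos q z y : 0 <= qform (pencil (blk i0 i0 q) (blk i0 i1 q) (blk i1 i1 q) z) y.
  rewrite -trace_qubit_proj//; have [_ h _] := Wd q; apply: h; exact: rank1_psd.
pose S q := \sum_(p : bool * 'I_s.+2) qform (pencil (blk i0 i0 q) (blk i0 i1 q) (blk i1 i1 q)
   (cayley p.2 * (1 + shift (e q) p.1))) (zero_vector K (cayley p.2) (shift (e q) p.1)).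
have S0 q : 0 <= S q by apply: sumr_ge0.
have trX q : (e q) ^- 5 * S q + gap K <= - 'Re (blk i0 i1 q (inord K.+2) (inord K.+1)).
  have [_ _] := hW q; rewrite trace_chain_operator//; last by case: (Wd q).
  by rewrite -/(blk i0 i1 q) -lerBrDr sub0r.
have low q : gap K <= - 'Re (blk i0 i1 q (inord K.+2) (inord K.+1)).
  apply: le_trans (trX q); rewrite lerDr mulr_ge0// invr_ge0 exprn_ge0// ltW//.
(* The projection part of the trace must be outweighed by one matrix entry, which is uniformly
   bounded by b. *)
have Sle q : S q <= e q ^+ 5 * b.
  rewrite -ler_pdivrMl ?exprn_gt0//.
  apply: (@le_trans _ _ (- 'Re (blk i0 i1 q (inord K.+2) (inord K.+1)))).
    by apply: le_trans (trX q); rewrite lerDl ltW// gap_gt0.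
  apply: le_trans (bb i0 i1 q (inord K.+2) (inord K.+1)).
  rewrite (le_trans (real_ler_norm _)) ?rpredN ?Creal_Re// normrN.
  rewrite -complexRe norm_real_complex; exact: normc_ge_Re.
apply: (@no_small_witness U hU C (bounded_ulim_complex hU) K (@cayley C) cayley_inj cayley_unit
   (blk i0 i0) (blk i0 i1) (blk i1 i1) e b (gap K) e_gt0 e_le1 e_lim) => //.
- by move=> q; apply: tens_block_adj.
- by move=> q; apply: tens_block_adj.
- by move=> q; have [_ ? _] := hW q.
- move=> q i sg hi /=; apply: le_trans (Sle q).
  rewrite /S (bigD1 (sg, Ordinal hi))//= lerDl; exact: sumr_ge0.
- exact: gap_gt0.
Qed.

End NoWitness.

(** * Compressions and the conclusion *)

Section Compression.
Context {C : numClosedFieldType}.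

Lemma compression_tens k s d (V : 'M[C]_(s, d)) (p : 'M[C]_k) (b : 'M[C]_s) :
  compression V (p *t b) = p *t (V ^t* *m b *m V).
Proof.
rewrite /compression adjmx_tens adjmx_scalar conjC1 !mxtens.tensmx_mul.
by rewrite mulmx1 mul1mx.
Qed.

End Compression.

Theorem mainTheorem2 (R : realType) (k d : nat) (hk : (2 <= k)%N)
    (hd : (1 <= d)%N) :
  exists (s : nat) (X : 'M[R[i]]_(k * s)),
    [/\ (d < s)%N, psdmx X, entangled X
      & forall V : 'M[R[i]]_(s, d), isometrymx V ->
          separable (compression V X)].
Proof.
pose i0 : 'I_k := Ordinal (ltnW hk); pose i1 : 'I_k := Ordinal hk.
have i01 : i0 != i1 by [].
(* K exceeds both d, the rank bound for lifted witnesses, and 1, the rank bound for [v *m v ^t*]. *)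
pose K := d.+1; pose s := (nedges K).+1.
have [e0 he0 neg] := chain_witness_operator_lt0 (C := R[i]) K i01 cayley_unit.
have [e [/andP[e_gt0 ee0] noW]] := exists_no_witness K i01 he0.
pose X := chain_operator K i0 i1 (@cayley R[i]) (@gap R[i] K) e.
have hX : X ^t* = X by apply: chain_operator_herm => //; rewrite ger0_real// ltW// gap_gt0.
have Xpsd : psdmx X.
  split; first exact/hermsymmxP.
  move=> v; rewrite -/(qform X v); apply: contrapT => nX.
  have v0 : v != 0 by apply/eqP => v0; apply: nX; rewrite /qform v0 mulmx0 mxE.
  pose c := (v ^t* *m v) 0 0.
  have cE : c = \sum_i (v i 0)^* * v i 0 by rewrite /c mxE; apply: eq_bigr => i _; rewrite !mxE.
  have c0 : 0 < c.
    rewrite lt_def cE sumr_ge0 ?andbT => [|i _]; last exact: mulJ_ge0.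
    apply: contraNneq v0 => /psumr_eq0P h; apply/eqP/colP => i; rewrite mxE.
    by apply/eqP; rewrite -mul_conjC_eq0 mulrC h// => j _; exact: mulJ_ge0.
  (* A vector with negative form would give the normalized rank-one witness, whose off-diagonal
     block has rank at most 1. *)
  have tr1 M : \tr (c^-1 *: (v *m v ^t*) *m M) = c^-1 * qform M v.
    by rewrite -scalemxAl linearZ /= -mulmxA mxtrace_mulC trace_mx11.
  apply: (noW (c^-1 *: (v *m v ^t*))); split; first split.
  - rewrite adjmxZ adjmx_mul trmxCK fmorphV /= (CrealP _)// gtr0_real//.
  - move=> p b hp hb; rewrite tr1 mulr_ge0 ?invr_ge0 ?(ltW c0)//.
    exact: (tens_psd hp hb).2.
  - by rewrite -[_ *: _]mulmx1 tr1 /qform mulmx1 -/c mulVf// gt_eqF.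
  - pose u a : 'cV[R[i]]_s := \col_i v (mxtens.mxtens_index (a, i)) 0.
    have -> : tens_block (c^-1 *: (v *m v ^t*)) i0 i1 = (c^-1 *: u i0) *m (u i1) ^t*.
      apply/matrixP => i j; rewrite !mxE !big_ord1 !mxE; ring.
    rewrite (leq_ltn_trans (mxrankM_maxr _ _))// (leq_ltn_trans (rank_leq_row _))//.
  - rewrite tr1 pmulr_rle0 ?invr_gt0//.
    have : qform X v \is Num.real by apply/CrealP/herm_qform_real.
    by move=> /real_ge0P => -[//|/ltW].
exists s, X; split.
- by rewrite /s /nedges /K; lia.
- exact: Xpsd.
- split=> // /sepsum_separable/(chain_witness_sepsum i01).
  by rewrite lt_geF// neg.
- move=> V hV; apply/sepsum_separable; apply: contrapT => nZ.
  have hZ : (compression V X) ^t* = compression V X.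
    by rewrite /compression !adjmx_mul trmxCK hX mulmxA.
  have [W [Wh Wp Wt] Wz] := entangled_witness hZ nZ.
  pose I := (1%:M : 'M[R[i]]_k) *t V.
  have trI M : \tr (I *m W *m I ^t* *m M) = \tr (W *m (I ^t* *m M *m I)).
    by rewrite -!mulmxA mxtrace_mulC !mulmxA.
  (* A witness against the compression lifts to one against X; the isometry property of V preserves
     its trace. *)
  apply: (noW (I *m W *m I ^t*)); split; first split.
  - by rewrite !adjmx_mul trmxCK Wh mulmxA.
  - move=> p b hp hb; rewrite trI -/(compression V (p *t b)) compression_tens; apply: Wp => //.
    have [w ->] := psd_rank1_sum hb.
    rewrite mulmx_sumr mulmx_suml; apply: psd_sum => i _.
    rewrite mulmxA -mulmxA -[w i ^t* *m V]trmxCK adjmx_mul trmxCK.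
    exact: rank1_psd.
  - rewrite -[_ *m _]mulmx1 trI mulmx1 /I adjmx_tens adjmx_scalar conjC1 mxtens.tensmx_mul.
    by rewrite mulmx1 hV tensmx11 mulmx1.
  - rewrite tens_block_conj (leq_ltn_trans (mxrankM_maxl _ _))// (leq_ltn_trans (mxrankM_maxl _ _))//.
    by rewrite (leq_ltn_trans (rank_leq_col _)).
  - by rewrite trI -/(compression V X).
Qed.
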